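(* Let $\mathcal{G}$ be the equilateral 3-star, consisting of three edges of length $1$ each, joined at a common central vertex. Up to symmetries of $\mathcal{G}$, every exhaustive rigid $2$-partition of $\mathcal{G}$ is of the form $\{\mathcal{G}_1(a),\mathcal{G}_2(a)\}$ for a unique $a\in[0,1)$, where the only cut point lies on a fixed edge at distance $a$ from the central vertex, $\mathcal{G}_2(a)$ is the interval of length $1-a$ between the cut point and the degree-one end of that edge, and $\mathcal{G}_1(a)$ consists of the other two edges together with the segment of length $a$ between the central vertex and the cut point. For each $p\in[1,\infty]$ there is a unique value $a=a_p\in[0,1)$ whose corresponding partition achieves $\mathcal{L}^D_{2,p}(\mathcal{G})$, that is, $\Lambda^D_p(\{\mathcal{G}_1(a_p),\mathcal{G}_2(a_p)\})=\mathcal{L}^D_{2,p}(\mathcal{G})$. Moreover, $a_p$ is a smooth function of $p$, with $a_p>0$ and $\frac{d}{dp}a_p<0$ for all $p\in[1,\infty)$, and $\lim_{p\to\infty}a_p=0$.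
   Context: For $a\in[0,1)$, $\lambda_1(\mathcal{G}_i(a))$ denotes the smallest eigenvalue of the Laplacian $-\frac{d^2}{dx^2}$ on $\mathcal{G}_i(a)$ with a Dirichlet condition at the cut point and natural (continuity plus Kirchhoff, i.e. Neumann at degree-one vertices) conditions at all other vertices; for $a=0$ the cut point is the central vertex itself, where a Dirichlet condition is imposed in both clusters. For a $2$-partition $\mathcal{P}=\{\mathcal{G}_1,\mathcal{G}_2\}$, $\Lambda^D_p(\mathcal{P})=\left(\frac12\left(\lambda_1(\mathcal{G}_1)^p+\lambda_1(\mathcal{G}_2)^p\right)\right)^{1/p}$ for $p\in[1,\infty)$ and $\Lambda^D_\infty(\mathcal{P})=\max\{\lambda_1(\mathcal{G}_1),\lambda_1(\mathcal{G}_2)\}$. $\mathcal{L}^D_{2,p}(\mathcal{G})$ is the infimum of $\Lambda^D_p(\mathcal{P})$ over all exhaustive rigid $2$-partitions $\mathcal{P}$ of $\mathcal{G}$. Here a $2$-partition of $\mathcal{G}$ consists of two distinct connected components (clusters) of a graph obtained from $\mathcal{G}$ by cutting through vertices (points of $\mathcal{G}$, after possibly declaring interior points of edges to be vertices of degree two), i.e. by splitting the set of edge endpoints identified at a vertex into subsets; it is exhaustive if there are no other components, and rigid if the only points cut nontrivially are those in the topological boundaries in $\mathcal{G}$ of the closed subsets of $\mathcal{G}$ corresponding to the clusters. *)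

(* Defs.v *)
From HB Require Import structures.
From mathcomp Require Import all_boot all_order all_algebra all_fingroup.
From mathcomp Require Import all_classical all_reals all_analysis.

Set Implicit Arguments.
Unset Strict Implicit.
Unset Printing Implicit Defensive.

Import Order.TTheory GRing.Theory Num.Theory.
Import numFieldNormedType.Exports.

Local Open Scope ring_scope.
Local Open Scope classical_set_scope.

(* A compact metric graph: every edge [e] is a copy of [0, len e], with
   endpoints [(e, false)] at coordinate 0 and [(e, true)] at coordinate
   [len e]; the vertices are the classes of the equivalence relation [vtx]. *)
Record metric_graph (R : realType) := MetricGraph {
  edge : finType;
  len : edge -> R;
  vtx : rel (edge * bool);
  len_gt0 : forall e, 0 < len e;
  vtx_equiv : equivalence_rel vtx }.

Notation endpoint G := (edge G * bool)%type.

Section Laplacian.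
Variables (R : realType) (G : metric_graph R).

Definition coord (p : endpoint G) : R := if p.2 then len p.1 else 0.

Definition inward_derivative (u : edge G -> R -> R) (p : endpoint G) : R :=
  (if p.2 then -1 else 1) * (u p.1)^`()%classic (coord p).

(* A function of class C^2 on [0, len e] is the restriction of one of class
   C^2 on R, so edgewise functions are taken on R; only their values on
   [0, len e] matter.  [D] is the set of endpoints at the Dirichlet vertices. *)
Definition in_domain (D : set (endpoint G)) (u : edge G -> R -> R) : Prop :=
  [/\ forall e x, [/\ derivable (u e) x 1, derivable (u e)^`() x 1
                    & {for x, continuous (u e)^`(2)}],
      forall p q, vtx p q -> u p.1 (coord p) = u q.1 (coord q),
      forall p, D p -> u p.1 (coord p) = 0
    & forall p, ~ D p -> \sum_(q | vtx p q) inward_derivative u q = 0].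

Definition eigenvalue (D : set (endpoint G)) (l : R) : Prop :=
  exists u : edge G -> R -> R,
    [/\ in_domain D u,
        exists e x, 0 <= x <= len e /\ u e x != 0
      & forall e x, 0 <= x <= len e -> - (u e)^`(2)%classic x = l * u e x].

Definition smallest_eigenvalue (D : set (endpoint G)) (l : R) : Prop :=
  eigenvalue D l /\ forall l', eigenvalue D l' -> l <= l'.

Definition lambda1 (D : set (endpoint G)) : R :=
  xget 0 [set l | smallest_eigenvalue D l].

End Laplacian.

Section PointsAndBoundary.
Variables (R : realType) (G : metric_graph R).

(* Points of the graph are represented by pairs (edge, coordinate) modulo
   [same_point], and its subsets by saturated sets of such pairs. *)
Definition is_point (q : edge G * R) : Prop := 0 <= q.2 <= len q.1.

Definition same_point (q q' : edge G * R) : Prop :=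
  q = q' \/ exists p p' : endpoint G,
    [/\ q = (p.1, coord p), q' = (p'.1, coord p') & vtx p p'].

(* Open sets of the quotient topology. *)
Definition graph_open (W : set (edge G * R)) : Prop :=
  [/\ forall q, W q -> is_point q,
      forall q q', same_point q q' -> W q -> W q'
    & forall e, exists2 O : set R, open O &
        forall x, 0 <= x <= len e -> (W (e, x) <-> O x)].

Definition boundary (A : set (edge G * R)) : set (edge G * R) :=
  [set q | is_point q /\ forall W, graph_open W -> W q ->
     (exists2 q', W q' & A q') /\ (exists2 q', W q' & ~ A q')].

End PointsAndBoundary.

(* Cutting through vertices.  An interior point of an edge is a vertex of
   degree two, whose only nontrivial cut separates its two endpoints; so a
   cut graph is given by the finitely many interior points at which the edges
   are severed, listed in increasing order, and by an equivalence relation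
   refining [vtx] on the original endpoints.  Uncut vertices of degree two are
   not recorded, so that distinct data give distinct cut graphs. *)
Record cut (R : realType) (G : metric_graph R) := Cut {
  cuts : edge G -> seq R;
  glue : rel (endpoint G);
  cuts_sorted : forall e, path <%R 0 (rcons (cuts e) (len e));
  glue_equiv : equivalence_rel glue;
  glue_vtx : subrel glue (@vtx R G) }.

Section CutGraph.
Variables (R : realType) (G : metric_graph R) (c : cut G).

Definition piece : finType := {e : edge G & 'I_(size (cuts c e)).+1}.

Definition piece_left (x : piece) : R :=
  nth 0 (0 :: cuts c (tag x)) (tagged x).
Definition piece_right (x : piece) : R :=
  nth (len (tag x)) (cuts c (tag x)) (tagged x).
Definition piece_len (x : piece) : R := piece_right x - piece_left x.

(* The endpoint of G from which an endpoint of a piece originates, if any. *)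
Definition origin (p : piece * bool) : option (endpoint G) :=
  let i : nat := tagged p.1 in
  if p.2 then
    if i == size (cuts c (tag p.1)) then Some (tag p.1, true) else None
  else if i == 0%N then Some (tag p.1, false) else None.

Definition piece_vtx (p q : piece * bool) : bool :=
  match origin p, origin q with
  | Some p', Some q' => glue c p' q'
  | _, _ => p == q
  end.

Lemma piece_len_gt0 x : 0 < piece_len x.
Proof.
rewrite /piece_len /piece_left /piece_right subr_gt0.
case: x => e [i Hi] /=.
move/(pathP (0 : R)): (cuts_sorted c e) => /(_ i).
rewrite size_rcons => /(_ Hi).
rewrite -rcons_cons !nth_rcons /= Hi.
move: Hi; rewrite ltnS leq_eqVlt => /orP[/eqP ->|Hi].
  by rewrite ltnn eqxx (nth_default _ (leqnn _)).
by rewrite Hi (set_nth_default (len e) 0 Hi).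
Qed.

Lemma piece_vtx_equiv : equivalence_rel piece_vtx.
Proof.
move=> p q r; have E := glue_equiv c; rewrite /piece_vtx; split.
  by case: (origin r) => // a; case: (E a a a).
case Ep: (origin p) => [a|]; last by move=> /eqP <-; rewrite Ep.
case Eq: (origin q) => [b|].
  move=> ab; case Er: (origin r) => [d|]; first by case: (E a b d) => _ ->.
  by apply/eqP/eqP => [Epr|Eqr]; [move: Ep|move: Eq]; rewrite ?Epr ?Eqr Er.
by move=> /eqP Epq; move: Ep; rewrite Epq Eq.
Qed.

Definition cut_graph : metric_graph R :=
  @MetricGraph R piece piece_len piece_vtx piece_len_gt0 piece_vtx_equiv.

(* The points of G that are cut nontrivially. *)
Definition cut_point (q : edge G * R) : Prop :=
  q.2 \in cuts c q.1 \/
  exists p p' : endpoint G,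
    [/\ q = (p.1, coord p), vtx p p' & ~~ glue c p p'].

End CutGraph.

Section Components.
Variables (R : realType) (G : metric_graph R).

Definition adjacent : rel (edge G) := fun e e' =>
  [exists b : bool, exists b' : bool, vtx (e, b) (e', b')].

Definition is_component (C : {set edge G}) : Prop :=
  exists e, C = finset (connect adjacent e).

Variable C : {set edge G}.

Definition sub_edge : finType := {e : edge G | e \in C}.

Definition sub_endpoint (p : sub_edge * bool) : endpoint G := (val p.1, p.2).

Definition sub_vtx (p q : sub_edge * bool) : bool :=
  vtx (sub_endpoint p) (sub_endpoint q).

Lemma sub_vtx_equiv : equivalence_rel sub_vtx.
Proof. by move=> p q r; exact: vtx_equiv. Qed.

Definition subgraph : metric_graph R :=
  @MetricGraph R sub_edge (fun e => len (val e)) sub_vtx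
    (fun e => len_gt0 (val e)) sub_vtx_equiv.

End Components.

(* A candidate 2-partition: two sets of edges of a cut graph of G. *)
Record cluster_pair (R : realType) (G : metric_graph R) := ClusterPair {
  pcut : cut G;
  cluster1 : {set edge (cut_graph pcut)};
  cluster2 : {set edge (cut_graph pcut)} }.

Section Partitions.
Variables (R : realType) (G : metric_graph R).

(* The closed subset of G corresponding to a cluster. *)
Definition support (c : cut G) (C : {set edge (cut_graph c)}) :
    set (edge G * R) :=
  [set q | exists x : edge (cut_graph c), exists t : R,
     [/\ x \in C, piece_left x <= t <= piece_right x
       & same_point q (tag x, t)]].

Definition partition2 (P : cluster_pair G) : Prop :=
  [/\ is_component (cluster1 P), is_component (cluster2 P)
    & cluster1 P != cluster2 P].

Definition exhaustive (P : cluster_pair G) : Prop :=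
  forall C : {set edge (cut_graph (pcut P))},
    is_component C -> C = cluster1 P \/ C = cluster2 P.

Definition rigid (P : cluster_pair G) : Prop :=
  forall q, cut_point (pcut P) q ->
    boundary (support (cluster1 P)) q \/ boundary (support (cluster2 P)) q.

Definition exhaustive_rigid_partition (P : cluster_pair G) : Prop :=
  [/\ partition2 P, exhaustive P & rigid P].

(* Endpoints of a cluster lying at cut points of G. *)
Definition cluster_dirichlet (c : cut G) (C : {set edge (cut_graph c)}) :
    set (endpoint (subgraph C)) :=
  [set p | cut_point c
     (tag (val p.1), if p.2 then piece_right (val p.1)
                     else piece_left (val p.1))].

Definition cluster_lambda1 (c : cut G) (C : {set edge (cut_graph c)}) : R :=
  lambda1 (@cluster_dirichlet c C).

(* The value at p = -oo is irrelevant: only 1 <= p <= +oo is considered. *)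
Definition LambdaD (p : \bar R) (P : cluster_pair G) : R :=
  let l1 := cluster_lambda1 (cluster1 P) in
  let l2 := cluster_lambda1 (cluster2 P) in
  match p with
  | EFin r => (2^-1 * (l1 `^ r + l2 `^ r)) `^ r^-1
  | +oo%E => Num.max l1 l2
  | -oo%E => 0
  end.

Definition LD2 (p : \bar R) : R :=
  inf [set LambdaD p P | P in exhaustive_rigid_partition].

End Partitions.

Arguments LD2 {R} G p.

Section Star.
Variable R : realType.

(* [(e, false)] is the central end of the edge [e]. *)
Definition star_vtx (p q : 'I_3 * bool) : bool := (p == q) || ~~ (p.2 || q.2).

Lemma star_len_gt0 (e : 'I_3) : (0 : R) < 1.
Proof. exact: ltr01. Qed.

Lemma star_vtx_equiv : equivalence_rel star_vtx.
Proof.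
move=> [e b] [e' b'] [e'' b'']; rewrite /star_vtx /= !xpair_eqE.
rewrite !eqxx; split=> //.
by case: b b' b'' => -[] [] //=;
  rewrite ?andbT ?andbF ?orbF ?orbT // => /eqP ->.
Qed.

Definition star3 : metric_graph R :=
  @MetricGraph R 'I_3 (fun _ => 1) star_vtx star_len_gt0 star_vtx_equiv.

(* The cut at distance [a] from the centre on the edge [ord0], meaningful for
   0 <= a < 1: for a > 0 the edge is severed, for a = 0 the edge [ord0] is
   detached from the other two edges at the centre. *)
Definition star_cuts (a : R) (e : edge star3) : seq R :=
  if (e == ord0) && (0 < a < 1) then [:: a] else [::].

Definition star_glue (a : R) (p q : endpoint star3) : bool :=
  star_vtx p q && ((0 < a) || ((p.1 == ord0) == (q.1 == ord0))).

Lemma star_cuts_sorted a e :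
  path <%R 0 (rcons (star_cuts a e) (@len R star3 e)).
Proof.
rewrite /star_cuts; case: ifP => /= [/and3P[_ -> ->] //|_].
by rewrite ltr01.
Qed.

Lemma star_glue_equiv a : equivalence_rel (star_glue a).
Proof.
move=> p q r; rewrite /star_glue eqxx orbT andbT.
have [-> E] := star_vtx_equiv p q r; split=> // /andP[/E -> ].
by case: (0 < a) => //= /eqP ->.
Qed.

Lemma star_glue_vtx a : subrel (star_glue a) star_vtx.
Proof. by move=> p q /andP[]. Qed.

Definition star_cut (a : R) : cut star3 :=
  @Cut R star3 (star_cuts a) (star_glue a) (@star_cuts_sorted a)
    (@star_glue_equiv a) (@star_glue_vtx a).

(* G_2(a) is the outermost piece of the edge [ord0]; G_1(a) is the rest. *)
Definition star_G2 (a : R) : {set edge (cut_graph (star_cut a))} :=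
  finset (fun x : edge (cut_graph (star_cut a)) =>
    (tag x == ord0) &&
    ((tagged x : nat) == size (cuts (star_cut a) (tag x)))).

Definition star_G1 (a : R) : {set edge (cut_graph (star_cut a))} :=
  ~: star_G2 a.

Definition star_partition (a : R) : cluster_pair star3 :=
  ClusterPair (star_G1 a) (star_G2 a).

(* The symmetries of the star are the permutations of its edges. *)
Definition star_image (s : {perm 'I_3}) (A : set (edge star3 * R)) :
    set (edge star3 * R) :=
  [set (s q.1, q.2) | q in A].

(* [P] is the image of [Q] under [s], as unordered pairs of clusters. *)
Definition star_symmetric (s : {perm 'I_3}) (P Q : cluster_pair star3) : Prop :=
  [/\ forall e : 'I_3, cuts (pcut P) (s e) = cuts (pcut Q) e,
      forall p q : 'I_3 * bool,
        glue (pcut P) (s p.1, p.2) (s q.1, q.2) = glue (pcut Q) p q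
    & (support (cluster1 P) = star_image s (support (cluster1 Q)) /\
       support (cluster2 P) = star_image s (support (cluster2 Q))) \/
      (support (cluster1 P) = star_image s (support (cluster2 Q)) /\
       support (cluster2 P) = star_image s (support (cluster1 Q)))].

End Star.

Definition smooth_on (R : realType) (U : set R) (f : R -> R) : Prop :=
  forall (n : nat) x, U x -> derivable f^`(n) x 1.

(* Main.v *)
Require Import Defs.
From HB Require Import structures.
From mathcomp Require Import all_boot all_order all_algebra all_fingroup.
From mathcomp Require Import all_classical all_reals all_analysis.
From mathcomp Require Import lra.

(** Let k be the frequency of the ground state of G_1(a), so that the first
    eigenvalue of that cluster is k^2.  On the two uncut edges the ground
    state is cos (k (1 - x)), x being the distance to the centre; continuity
    and the Kirchhoff condition then force cos k cos (k x) - 2 sin k sin (k x)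
    on the severed edge, and the Dirichlet condition at the cut reads
      2 sin k sin (k a) = cos k cos (k a).
    The same formulas with a frequency m < k give a solution that is positive
    on the whole closed cluster.  By Picone's identity, on a graph carrying
    such a positive solution no eigenvalue lies below m^2
    ([positive_solution_le_eigenvalue]); letting m tend to k shows that k^2 is
    the smallest eigenvalue ([lambda1_ground_state]).  The interval G_2(a) has
    the first eigenvalue (pi / (2 (1 - a)))^2 for the same reason.

    The Dirichlet condition is transcendental in k but explicit in a: it says
    a = atan (cot k / 2) / k, a strictly decreasing function of k that maps
    ]kmin, pi/2] onto [0, 1[ ([cut_position]).  All the analysis is therefore
    done in the variable k.  Up to the monotone map t -> (t / 2)^(1/p), the
    quantity to be minimized is
      [energy p k] = k^(2p) + (pi / (2 (1 - a)))^(2p),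
    and its derivative in k has the sign of [balance p k], the difference of
    the logarithms of its two competing terms.  That function is strictly
    increasing in k, negative where a = 1/2 and positive at k = pi/2, where
    a = 0: it has exactly one zero, which is the unique minimizer and gives
    0 < a_p.  At p = +oo the larger eigenvalue is that of G_2(a), increasing
    in a, whence a = 0.

    Moreover [balance p k] is affine in p, so its zero set is also the graph
    of an explicit function p = [exponent k], with a positive derivative at
    the points in question.  The critical frequency is the inverse of that
    function, hence smooth and increasing in p, and a_p, a decreasing function
    of it, is smooth and decreasing.  As soon as p > [exponent k], the critical
    frequency exceeds k; letting k tend to pi/2 yields the limit of a_p.

    The classification of the partitions is a count of components.  In a cut
    star, a piece that does not touch the centre is a component by itself,
    while the pieces touching the centre are grouped as their central ends are
    glued.  Two components therefore mean either one severed edge and an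
    untouched centre (a > 0), or no severed edge and one central end detached
    from the other two (a = 0).  A permutation of the edges that matches the
    cuts matches the components, the supports and the eigenvalues
    ([star_symmetric_partition]), so the infimum runs over the G_i(a) only. *)

Set Implicit Arguments.
Unset Strict Implicit.
Unset Printing Implicit Defensive.

Import Order.TTheory GRing.Theory Num.Theory.
Import numFieldNormedType.Exports.
(* [coord] and [eigenvalue] also name notions of linear algebra. *)
Import Defs.

Local Open Scope ring_scope.
Local Open Scope classical_set_scope.

(** * Derivatives of real functions at a point *)

Section PointwiseDerivatives.
Variable R : realType.
Implicit Types (f g : R -> R) (x c df dg : R).

Lemma der_eq f x df dg : is_derive x 1 f df -> df = dg -> is_derive x 1 f dg.
Proof. by move=> + <-. Qed.

Lemma der_cst c x : is_derive x 1 (fun _ : R => c) 0.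
Proof. exact: is_derive_cst. Qed.

Lemma der_id x : is_derive x 1 (fun y : R => y) 1.
Proof. exact: is_derive_id. Qed.

Lemma der_add f g x df dg : is_derive x 1 f df -> is_derive x 1 g dg ->
  is_derive x 1 (fun y => f y + g y) (df + dg).
Proof. exact: is_deriveD. Qed.

Lemma der_opp f x df : is_derive x 1 f df ->
  is_derive x 1 (fun y => - f y) (- df).
Proof. exact: is_deriveN. Qed.

Lemma der_sub f g x df dg : is_derive x 1 f df -> is_derive x 1 g dg ->
  is_derive x 1 (fun y => f y - g y) (df - dg).
Proof. exact: is_deriveB. Qed.

Lemma der_mul f g x df dg : is_derive x 1 f df -> is_derive x 1 g dg ->
  is_derive x 1 (fun y => f y * g y) (df * g x + f x * dg).
Proof.
by move=> Df Dg; apply: der_eq (is_deriveM Df Dg) _;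
  rewrite /GRing.scale /= addrC [g x * _]mulrC.
Qed.

Lemma der_scale c f x df : is_derive x 1 f df ->
  is_derive x 1 (fun y => c * f y) (c * df).
Proof.
by move=> Df; apply: der_eq (der_mul (der_cst c x) Df) _; rewrite mul0r add0r.
Qed.

Lemma der_inv f x df : is_derive x 1 f df -> f x != 0 ->
  is_derive x 1 (fun y => (f y)^-1) (- (df / f x ^+ 2)).
Proof.
move=> Df fx; apply: der_eq (is_deriveV fx Df) _.
by rewrite /GRing.scale /= mulNr mulrC.
Qed.

Lemma der_comp f g x df dg : is_derive x 1 g dg -> is_derive (g x) 1 f df ->
  is_derive x 1 (fun y => f (g y)) (df * dg).
Proof. by move=> Dg Df; exact: is_derive1_comp. Qed.

Lemma der_continuous f x df : is_derive x 1 f df -> {for x, continuous f}.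
Proof. by case=> Df _; exact/differentiable_continuous/derivable1_diffP. Qed.

Lemma der_derive1 f x df : is_derive x 1 f df -> derive1 f x = df.
Proof. by case=> _ Df; rewrite derive1E. Qed.

End PointwiseDerivatives.

(** * Picone comparison on metric graphs *)

(** Boundary terms on a metric graph are balanced vertex by vertex; this turns
    the balance at each vertex into a global one. *)
Lemma sum_classes_eq0 (T : finType) (V : nmodType) (r : rel T) (F : T -> V) :
  equivalence_rel r -> (forall p, \sum_(q | r p q) F q = 0) ->
  \sum_q F q = 0.
Proof.
move=> rE rF.
rewrite (partition_big (fun q => finset (r q)) xpredT) //=.
apply: big1 => A _.
case: (pickP (fun q => finset (r q) == A)) => [q0 /eqP <-|A0]; last first.
  by rewrite big_pred0.
rewrite -[RHS](rF q0); apply: eq_bigl => q; apply/eqP/idP => [qq0|q0q].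
  have : q \in finset (r q0) by rewrite -qq0 inE; case: (rE q q q).
  by rewrite inE.
apply/setP => x; rewrite !inE.
by case: (rE q0 q x) => _ /(_ q0q) ->.
Qed.

Section Picone.
Variable R : realType.

(** Picone's identity.  The right-hand side is nonnegative when l <= m, which
    makes the differentiated quantity nondecreasing. *)
Lemma picone_derive (u u' w w' : R -> R) (l m x : R) : w x != 0 ->
  is_derive x 1 u (u' x) -> is_derive x 1 u' (- (l * u x)) ->
  is_derive x 1 w (w' x) -> is_derive x 1 w' (- (m * w x)) ->
  is_derive x 1 (fun y => u y * u' y - u y ^+ 2 * (w' y / w y))
    ((u' x - u x * (w' x / w x)) ^+ 2 + (m - l) * u x ^+ 2).
Proof.
move=> w0 Du Ddu Dw Ddw.
have DwV := is_deriveV w0 Dw.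
rewrite (_ : (fun _ => _) = u * u' - u ^+ 2 * (w' * (fun y => (w y)^-1)))//.
apply: is_derive_eq.
rewrite /= /GRing.scale /= !fctE.
rewrite /GRing.scale /= -exprVn.
have be := mulfV w0.
have -> : (w x)^-1 * - (m * w x) = - m by rewrite mulrN mulrCA mulVf ?mulr1.
move: (u x) (u' x) (w' x) (w x)^-1 => a c d e.
nra.
Qed.

Variable G : metric_graph R.

(** Suppose l < m.  The Picone quantity is nondecreasing along every edge,
    while the sum of its increments over all edges is a sum of boundary terms
    that cancel at each vertex: Kirchhoff for both functions off D, u = 0 on D.
    Hence it is constant on every edge, its derivative vanishes, and so does
    (m - l) u^2. *)
Lemma positive_solution_le_eigenvalue (D : set (endpoint G)) (m l : R)
    (w w' : edge G -> R -> R) :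
  (forall e (x : R), is_derive x 1 (w e) (w' e x)) ->
  (forall e (x : R), is_derive x 1 (w' e) (- (m * w e x))) ->
  (forall p q, vtx p q -> w p.1 (coord p) = w q.1 (coord q)) ->
  (forall p, ~ D p ->
     \sum_(q | vtx p q) (if q.2 then -1 else 1) * w' q.1 (coord q) = 0) ->
  (forall e x, 0 <= x <= len e -> 0 < w e x) ->
  eigenvalue D l -> m <= l.
Proof.
move=> Dw Ddw wc wK w_gt0 [u [[uC2 uc uD uK] [e0 [x0 [x0e u0]]] ul]].
rewrite leNgt; apply/negP => lm.
pose u' e := derive1 (u e).
have Du e (x : R) : is_derive x 1 (u e) (u' e x).
  have [due _ _] := uC2 e x.
  by rewrite /u' derive1E; exact: (derivableP due).
have Ddu e (x : R) : 0 <= x <= len e -> is_derive x 1 (u' e) (- (l * u e x)).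
  move=> xe; rewrite -ul// opprK derive1nS derive1n1 derive1E.
  by have [_ ddue _] := uC2 e x; exact: (derivableP ddue).
pose psi e (x : R) : R := u e x * u' e x - u e x ^+ 2 * (w' e x / w e x).
pose dpsi e (x : R) : R := (u' e x - u e x * (w' e x / w e x)) ^+ 2 +
                 (m - l) * u e x ^+ 2.
have Dpsi e (x : R) : 0 <= x <= len e -> is_derive x 1 (psi e) (dpsi e x).
  move=> xe; have w0 := lt0r_neq0 (w_gt0 _ _ xe).
  exact: (picone_derive w0 (Du e x) (Ddu e x xe) (Dw e x) (Ddw e x)).
have dpsi_ge0 e x : 0 <= dpsi e x.
  by rewrite addr_ge0 ?sqr_ge0// mulr_ge0 ?sqr_ge0// subr_ge0 ltW.
have psi_homo e x y : 0 <= x -> x <= y -> y <= len e -> psi e x <= psi e y.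
  move=> x0' xy ye.
  have [||c cxy psiE] := @MVT_segment _ (psi e) (dpsi e) x y xy.
  - move=> z /andP[]; rewrite !bnd_simp => /ltW xz /ltW zy.
    by apply: Dpsi; rewrite (le_trans x0' xz) (le_trans zy ye).
  - apply: derivable_within_continuous => z /andP[]; rewrite !bnd_simp => xz zy.
    by apply/ex_derive/Dpsi; rewrite (le_trans x0' xz) (le_trans zy ye).
  by rewrite -subr_ge0 psiE mulr_ge0 ?subr_ge0.
have psi_sum : \sum_(p : endpoint G)
    (if p.2 then -1 else 1) * psi p.1 (coord p) = 0.
  apply: (sum_classes_eq0 (@vtx_equiv _ G)) => p.
  have [Dp|nDp] := pselect (D p).
    apply: big1 => q pq; rewrite /psi -(uc _ _ pq) uD//.
    by rewrite expr0n/= !mul0r subrr mulr0.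
  rewrite (eq_bigr (fun q =>
     u p.1 (coord p) * inward_derivative u q -
     u p.1 (coord p) ^+ 2 / w p.1 (coord p) *
       ((if q.2 then -1 else 1) * w' q.1 (coord q)))); last first.
    move=> q pq; rewrite /psi -(uc _ _ pq) -(wc _ _ pq) /inward_derivative.
    rewrite -/(u' q.1 (coord q)); move: (if q.2 then _ else _) => s.
    by lra.
  rewrite sumrB -!mulr_sumr uK// wK// !mulr0 subrr//.
have psi_ends e : psi e (len e) = psi e 0.
  have : \sum_e0 (psi e0 (len e0) - psi e0 0) = 0.
    apply: oppr_inj; rewrite oppr0 -[RHS]psi_sum -sumrN.
    rewrite -(pair_bigA _ (fun e (b : bool) =>
      (if b then -1 else 1) * psi e (if b then len e else 0))) /=.
    by apply: eq_bigr => i _; rewrite big_bool /= mul1r mulN1r opprB addrC.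
  move/eqP; rewrite psumr_eq0; last first.
    by move=> i _; rewrite subr_ge0 psi_homo// ltW// len_gt0.
  move/allP => /(_ e); rewrite mem_index_enum => /(_ isT).
  by rewrite subr_eq0 => /eqP.
have psi_cst e x : 0 <= x <= len e -> psi e x = psi e 0.
  move=> /andP[x_ge0 xle]; apply/eqP; rewrite eq_le -{1}psi_ends.
  by rewrite !psi_homo.
have u_eq0 e x : 0 < x < len e -> u e x = 0.
  move=> /andP[x_gt0 xlt].
  have := Dpsi e x; rewrite !ltW// => /(_ isT) [_].
  rewrite (near_eq_derive (g := cst (psi e 0))); last first.
    near=> y; apply: psi_cst; rewrite !ltW//.
      by near: y; exact: lt_nbhsl.
    by near: y; exact: lt_nbhsr.
  rewrite derive_cst => /esym/eqP.
  rewrite paddr_eq0 ?sqr_ge0//; last by rewrite mulr_ge0 ?sqr_ge0 ?subr_ge0 ?ltW.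
  move=> /andP[_]; rewrite mulf_eq0 subr_eq0 gt_eqF//= => /eqP.
  by move/eqP; rewrite sqrf_eq0 => /eqP.
(* If x0 is an endpoint, continuity provides an interior point where u does
   not vanish either. *)
have u_cts : {for x0, continuous (u e0)}.
  exact/differentiable_continuous/derivable1_diffP/ex_derive.
have [d /= d_gt0 ud] : \forall y \near x0, u e0 y != 0.
  exact: (u_cts _ (open_nbhs_nbhs (conj (@open_neq _ 0) u0))).
have L_gt0 := len_gt0 e0; set L := len e0 in x0e L_gt0.
pose t := Num.min 2^-1 (d / L).
have t_gt0 : 0 < t by rewrite lt_min invr_gt0 ltr0n divr_gt0.
have t_le : t <= 2^-1 by rewrite ge_min lexx.
have tL : t * L <= d by rewrite -ler_pdivlMr// ge_min lexx orbT.
have [x0_ge0 x0_le] := andP x0e.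
pose y := x0 + t * (L / 2 - x0).
have h1 : 0 <= x0 * (1 - t) by rewrite mulr_ge0//; lra.
have h2 : 0 <= (L - x0) * (1 - t) by rewrite mulr_ge0//; lra.
have h3 : 0 < t * L by rewrite mulr_gt0.
have h4 : 0 <= t * x0 by rewrite mulr_ge0// ltW.
have h5 : 0 <= t * (L - x0) by rewrite mulr_ge0//; lra.
have y_in : 0 < y < L by rewrite /y; lra.
suff /ud : ball x0 d y by rewrite u_eq0// eqxx.
rewrite /ball /= /y opprD addNKr normrN ltr_norml; lra.
Unshelve. all: end_near.
Qed.

(** The minimality of k^2 is approached from below: for m < k the member
    [phi m] of the family is positive up to the Dirichlet vertices, so the
    comparison principle applies to it, although it does not apply to [phi k]
    itself. *)
Lemma lambda1_ground_state (D : set (endpoint G)) (k : R)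
    (phi phi' : R -> edge G -> R -> R) :
  0 < k ->
  (forall m e (x : R), is_derive x 1 (phi m e) (phi' m e x)) ->
  (forall m e (x : R), is_derive x 1 (phi' m e) (- (m ^+ 2 * phi m e x))) ->
  (forall m p q, vtx p q -> phi m p.1 (coord p) = phi m q.1 (coord q)) ->
  (forall m p, ~ D p ->
     \sum_(q | vtx p q) (if q.2 then -1 else 1) * phi' m q.1 (coord q) = 0) ->
  (forall m e x, 0 < m < k -> 0 <= x <= len e -> 0 < phi m e x) ->
  (forall p, D p -> phi k p.1 (coord p) = 0) ->
  (exists e x, 0 <= x <= len e /\ phi k e x != 0) ->
  lambda1 D = k ^+ 2.
Proof.
move=> k_gt0 Dphi Ddphi phic phiK phi_gt0 phiD phi_neq0.
have d1 e : derive1 (phi k e) = phi' k e.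
  by apply/funext => x; rewrite derive1E; have [_ ->] := Dphi k e x.
have d2 e : derive1 (derive1 (phi k e)) = (fun x => - (k ^+ 2 * phi k e x)).
  by apply/funext => x; rewrite d1 derive1E; have [_ ->] := Ddphi k e x.
have eig : eigenvalue D (k ^+ 2).
  exists (phi k); split => //; last first.
    by move=> e x _; rewrite derive1nS derive1n1 d2 opprK.
  split=> // [e x|p q|p nDp]; [|exact: phic|]; last first.
    by rewrite -[RHS](phiK k p nDp); apply: eq_bigr => q _; rewrite -d1.
  split; first by have [] := Dphi k e x.
    by rewrite d1; have [] := Ddphi k e x.
  rewrite derive1nS derive1n1 d2.
  have c : {for x, continuous (phi k e)}.
    apply/differentiable_continuous/derivable1_diffP.
    by have [] := Dphi k e x.
  by apply: continuousN; apply: continuousM; first exact: cst_continuous.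
have small : smallest_eigenvalue D (k ^+ 2).
  split=> // l eigl; rewrite leNgt; apply/negP => lk.
  have [m m_in lm] : exists2 m, 0 < m < k & l < m ^+ 2.
    have [l0|l0] := ltP l 0.
      exists (k / 2); first by apply/andP; split; lra.
      by rewrite (lt_le_trans l0)// sqr_ge0.
    pose s := Num.sqrt l; have s0 : 0 <= s by exact: sqrtr_ge0.
    have sE : s ^+ 2 = l by exact: sqr_sqrtr.
    have sk : s < k by rewrite -(@ltr_pXn2r _ 2%N)// ?nnegrE ?ltW// sE.
    exists ((s + k) / 2); first by apply/andP; split; lra.
    rewrite -sE; nra.
  have := @positive_solution_le_eigenvalue D (m ^+ 2) l (phi m) (phi' m)
    (Dphi m) (Ddphi m) (phic m) (phiK m)
    (fun e x => phi_gt0 m e x m_in) eigl.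
  by rewrite leNgt lm.
rewrite /lambda1; case: xgetP => [l _ [eigl lmin]|/(_ _ small)//].
by apply/eqP; rewrite eq_le lmin//; case: small => _ ->.
Qed.

End Picone.

(** * Isometries, and cuts of the star related by a permutation of its edges *)

Section Isometry.
Variables (R : realType) (G H : metric_graph R).
Variables (DG : set (endpoint G)) (DH : set (endpoint H)).
Variables (f : edge G -> edge H) (g : edge H -> edge G).

Lemma eigenvalue_isometry l : cancel f g -> cancel g f ->
  (forall e, len (f e) = len e) ->
  (forall p q, vtx (f p.1, p.2) (f q.1, q.2) = vtx p q) ->
  (forall p, DH (f p.1, p.2) <-> DG p) ->
  eigenvalue DH l -> eigenvalue DG l.
Proof.
move=> fK gK flen fvtx fD [u [[uC2 uc uD uK] [e0 [x0 [x0e u0]]] ul]].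
have fcoord (p : endpoint G) : coord (f p.1, p.2) = coord p.
  by rewrite /coord /= flen.
exists (fun e => u (f e)); split.
- split=> [e x|p q pq|p Dp|p nDp]; first exact: uC2.
  + by have := uc (f p.1, p.2) (f q.1, q.2); rewrite fvtx !fcoord; exact.
  + by have := uD (f p.1, p.2); rewrite fcoord; apply; exact/fD.
  + have nDfp : ~ DH (f p.1, p.2) by move=> /fD.
    rewrite -[RHS](uK _ nDfp) [RHS](reindex (fun q : endpoint G => (f q.1, q.2))) /=; last first.
      by apply: onW_bij; exists (fun q => (g q.1, q.2)) => -[e b] /=;
        rewrite ?fK ?gK.
    apply: eq_big => [q|q _]; first by rewrite fvtx.
    by rewrite /inward_derivative -fcoord.
- by exists (g e0), x0; rewrite -flen gK.
- by move=> e x; rewrite -flen; exact: ul.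
Qed.

End Isometry.

Lemma lambda1_isometry (R : realType) (G H : metric_graph R)
    (DG : set (endpoint G)) (DH : set (endpoint H))
    (f : edge G -> edge H) (g : edge H -> edge G) :
  cancel f g -> cancel g f ->
  (forall e, len (f e) = len e) ->
  (forall p q, vtx (f p.1, p.2) (f q.1, q.2) = vtx p q) ->
  (forall p, DH (f p.1, p.2) <-> DG p) ->
  lambda1 DH = lambda1 DG.
Proof.
move=> fK gK flen fvtx fD.
suff E l : eigenvalue DH l <-> eigenvalue DG l.
  rewrite /lambda1; congr xget; apply/seteqP; split=> l /= [/E El lmin];
    split=> // l' /E; exact: lmin.
split; first exact: (eigenvalue_isometry fK gK).
apply: (eigenvalue_isometry gK fK) => [e|p q|p].
- by rewrite -flen gK.
- by rewrite -fvtx /= !gK; case: p q => ? ? [? ?].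
- by rewrite -fD /= gK; case: p.
Qed.

Section StarCuts.
Variable R : realType.
Implicit Types (c : cut (star3 R)) (a : R).

Lemma piece_eq c (x y : piece c) :
  tag x = tag y -> (tagged x : nat) = tagged y -> x = y.
Proof.
case: x y => e i [e' j] /= ee'; case: _ / ee' in j *.
by move=> /val_inj ->.
Qed.

Lemma glue_outer c (e e' : 'I_3) (b b' : bool) : b || b' ->
  glue c (e, b) (e', b') = ((e, b) == (e', b')).
Proof.
move=> bb'; apply/idP/eqP => [/glue_vtx|->]; last first.
  by case: (glue_equiv c (e', b') (e', b') (e', b')).
by rewrite /= /star_vtx /= bb' orbF => /eqP.
Qed.

Lemma piece_vtxE c (p q : piece c * bool) : piece_vtx p q =
  (p == q) || [&& ~~ p.2, ~~ q.2, (tagged p.1 : nat) == 0%N,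
     (tagged q.1 : nat) == 0%N & glue c (tag p.1, false) (tag q.1, false)].
Proof.
case: p q => [x b] [y b'].
have [<-|nxy] := eqVneq (x, b) (y, b').
  by have [] := piece_vtx_equiv (x, b) (x, b) (x, b).
rewrite /piece_vtx /origin /= (negPf nxy).
case: b b' nxy => [] [] nxy /=.
- case: eqP => // xs; case: eqP => // ys.
  rewrite glue_outer//; apply/eqP => -[xy].
  by move/eqP: nxy; apply; congr pair; apply: piece_eq => //; rewrite xs ys xy.
- case: eqP => // xs; case: eqP => // ys.
  by rewrite glue_outer//; apply/eqP.
- case: eqP => // xs; case: eqP => // ys.
  by rewrite glue_outer//; apply/eqP.
- by case: eqP => // xs; case: eqP.
Qed.

(** Only first pieces meet at the centre, and the outer ends are free, so that
    adjacency is already an equivalence relation. *)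
Lemma adjacentE c (x y : edge (cut_graph c)) : adjacent x y =
  (x == y) || [&& (tagged x : nat) == 0%N,
     (tagged y : nat) == 0%N & glue c (tag x, false) (tag y, false)].
Proof.
apply/existsP/orP => [[b /existsP[b']]|[/eqP ->|xy]].
- rewrite [vtx _ _]piece_vtxE /= => /orP[/eqP[-> _]|/and5P[_ _ -> -> ->]].
    by left.
  by right.
- by exists true; apply/existsP; exists true; rewrite [vtx _ _]piece_vtxE eqxx.
- by exists false; apply/existsP; exists false;
    rewrite [vtx _ _]piece_vtxE /= xy orbT.
Qed.

Lemma connect_adjacent c (x y : edge (cut_graph c)) :
  connect (@adjacent R (cut_graph c)) x y = adjacent x y.
Proof.
apply/idP/idP => [|/connect1//]; case/connectP => s.
have step z t : adjacent x z -> adjacent z t -> adjacent x t.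
  rewrite !adjacentE => /orP[/eqP ->//|/and3P[-> z0 xz]].
  case/orP => [/eqP <-|/and3P[_ -> zt]]; first by rewrite z0 xz orbT.
  have [_ /(_ xz) ->] := glue_equiv c (tag x, false) (tag z, false) (tag t, false).
  by rewrite zt orbT.
have: adjacent x x by rewrite adjacentE eqxx.
elim: s {2 3 4}x => [|z s IH] w /=; first by move=> xw _ ->.
by move=> xw /andP[wz ps] yE; exact: IH (step _ _ xw wz) ps yE.
Qed.

Lemma is_componentP c (C : {set edge (cut_graph c)}) :
  is_component C <->
  exists x : edge (cut_graph c), C = finset (adjacent x).
Proof.
split=> -[x ->]; exists x; apply/setP => y; rewrite !inE.
  exact: connect_adjacent.
by rewrite connect_adjacent.
Qed.

Section Transport.
Variables (c c' : cut (star3 R)) (s : {perm 'I_3}).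
Hypothesis cuts_s : forall e : 'I_3, cuts c (s e) = cuts c' e.
Hypothesis glue_s : forall p q : 'I_3 * bool,
  glue c (s p.1, p.2) (s q.1, q.2) = glue c' p q.

Fact move_piece_bound (e : 'I_3) :
  (size (cuts c' e)).+1 = (size (cuts c (s e))).+1.
Proof. by rewrite cuts_s. Qed.

(** The bijection between the pieces of two cuts that correspond to each other
    under the permutation [s] of the edges. *)
Definition move_piece (x : piece c') : piece c :=
  existT _ (s (tag x)) (cast_ord (move_piece_bound (tag x)) (tagged x)).

Lemma move_piece_inj : injective move_piece.
Proof.
move=> x y /(congr1 (fun z => (tag z, nat_of_ord (tagged z)))) /= [] /perm_inj.
exact: piece_eq.
Qed.

Lemma move_piece_surj y : exists x, move_piece x == y.
Proof.
have lt : (tagged y < (size (cuts c' (s^-1%g (tag y)))).+1)%N.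
  by rewrite -cuts_s permKV.
exists (existT _ (s^-1%g (tag y)) (Ordinal lt)); apply/eqP.
by apply: piece_eq => //=; rewrite permKV.
Qed.

Definition move_back y : piece c' := xchoose (move_piece_surj y).

Lemma move_backK : cancel move_back move_piece.
Proof. by move=> y; apply/eqP/(xchooseP (move_piece_surj y)). Qed.

Lemma move_pieceK : cancel move_piece move_back.
Proof. by move=> x; apply: move_piece_inj; rewrite move_backK. Qed.

Lemma move_left x : piece_left (move_piece x) = piece_left x.
Proof. by rewrite /piece_left /= cuts_s. Qed.

Lemma move_right x : piece_right (move_piece x) = piece_right x.
Proof. by rewrite /piece_right /= cuts_s. Qed.

Lemma move_adjacent x y :
  @adjacent R (cut_graph c) (move_piece x) (move_piece y) =
  @adjacent R (cut_graph c') x y.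
Proof.
rewrite !adjacentE (inj_eq move_piece_inj) /=.
by rewrite -(glue_s (tag x, false) (tag y, false)).
Qed.

Lemma move_vtx x y b b' :
  piece_vtx (move_piece x, b) (move_piece y, b') = piece_vtx (x, b) (y, b').
Proof.
rewrite !piece_vtxE /= !xpair_eqE (inj_eq move_piece_inj).
by rewrite -(glue_s (tag x, false) (tag y, false)).
Qed.

Lemma star_vtx_perm (p q : 'I_3 * bool) :
  star_vtx (s p.1, p.2) (s q.1, q.2) = star_vtx p q.
Proof.
by case: p q => [e b] [e' b']; rewrite /star_vtx !xpair_eqE (inj_eq perm_inj).
Qed.

Lemma same_point_perm (q q' : 'I_3 * R) :
  @same_point R (star3 R) (s q.1, q.2) (s q'.1, q'.2) <->
  @same_point R (star3 R) q q'.
Proof.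
split=> -[]; case: q q' => e t [e' t'] /=.
- by case=> /perm_inj -> ->; left.
- case=> -[p b] [[p' b']] /= [[<- ->] [<- ->]] v.
  right; exists (s^-1%g (s e), b), (s^-1%g (s e'), b').
  by rewrite /= !permK; split=> //; have := star_vtx_perm (e, b) (e', b') => /= <-.
- by case=> -> ->; left.
- case=> -[p b] [[p' b']] /= [[-> ->] [-> ->]] v.
  right; exists (s p, b), (s p', b'); split=> //.
  by have := star_vtx_perm (p, b) (p', b') => /= ->.
Qed.

Lemma cut_point_perm (e : 'I_3) (t : R) :
  cut_point c (s e, t) <-> cut_point c' (e, t).
Proof.
rewrite /cut_point /= cuts_s; split=> -[|[[p b] [[p' b'] /= [[E ->] v g]]]].
- by left.
- right; exists (e, b), (s^-1%g p', b'); rewrite /=; split=> //.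
    by have := star_vtx_perm (e, b) (s^-1%g p', b') => /= <-; rewrite permKV E.
  by have := glue_s (e, b) (s^-1%g p', b') => /= <-; rewrite permKV E.
- by left.
- right; exists (s p, b), (s p', b'); rewrite /=; split=> //.
  + by rewrite E.
  + by have := star_vtx_perm (p, b) (p', b') => /= ->.
  + by have := glue_s (p, b) (p', b') => /= ->.
Qed.

Variables (C : {set edge (cut_graph c)}) (C' : {set edge (cut_graph c')}).
Hypothesis C_s : forall x : edge (cut_graph c'), (move_piece x \in C) = (x \in C').

Lemma move_support : support C = star_image s (support C').
Proof.
apply/seteqP; split=> q.
  case=> x [t [xC xt qx]]; exists (s^-1%g q.1, q.2) => /=; last first.
    by rewrite permKV; case: q qx.
  exists (move_back x), t; split.
  - by rewrite -C_s move_backK.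
  - by rewrite -move_left -move_right move_backK.
  - apply/same_point_perm => /=; rewrite permKV.
    have <- : tag x = s (tag (move_back x)) by rewrite -[LHS]/(tag x) -{1}(move_backK x).
    by case: q qx.
case=> q' [x [t [xC xt qx]]] <-.
exists (move_piece x), t; split; first by rewrite C_s.
  by rewrite move_left move_right.
exact: (proj2 (same_point_perm q' (tag x, t)) qx).
Qed.

Lemma move_cluster_lambda1 : cluster_lambda1 C = cluster_lambda1 C'.
Proof.
have fP (x : sub_edge C') : move_piece (val x) \in C.
  by rewrite C_s; exact: valP.
have gP (y : sub_edge C) : move_back (val y) \in C'.
  by rewrite -C_s move_backK; exact: valP.
apply: (@lambda1_isometry R (subgraph C') (subgraph C) _ _
  (fun x => exist _ (move_piece (val x)) (fP x))
  (fun y => exist _ (move_back (val y)) (gP y))).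
- by move=> x; apply: val_inj; rewrite /= move_pieceK.
- by move=> y; apply: val_inj; rewrite /= move_backK.
- by move=> x; rewrite /= /piece_len move_left move_right.
- by move=> p q; exact: move_vtx.
- move=> [x b]; rewrite /cluster_dirichlet /= move_left move_right.
  exact: cut_point_perm.
Qed.

End Transport.

(** Adjacency corresponds under [move_piece], hence so do components; as both
    partitions are exhaustive, the clusters correspond in one of the two
    orders, and LambdaD is symmetric in the clusters. *)
Lemma star_symmetric_partition (P Q : cluster_pair (star3 R)) (s : {perm 'I_3}) :
  partition2 P -> exhaustive P -> partition2 Q -> exhaustive Q ->
  (forall e : 'I_3, cuts (pcut P) (s e) = cuts (pcut Q) e) ->
  (forall p q : 'I_3 * bool,
     glue (pcut P) (s p.1, p.2) (s q.1, q.2) = glue (pcut Q) p q) ->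
  star_symmetric s P Q /\ forall p, LambdaD p P = LambdaD p Q.
Proof.
move=> [P1 P2 P12] Pex [Q1 Q2 Q12] Qex cs gs.
pose f : edge (cut_graph (pcut Q)) -> edge (cut_graph (pcut P)) := move_piece cs.
have pre (C : {set edge (cut_graph (pcut P))}) : is_component C -> is_component (f @^-1: C).
  case/is_componentP => x ->; apply/is_componentP.
  exists (move_back cs x); apply/setP => y; rewrite !inE.
  by rewrite -[RHS](move_adjacent cs gs) move_backK.
have inj (C C' : {set edge (cut_graph (pcut P))}) : f @^-1: C = f @^-1: C' -> C = C'.
  move=> /setP CC; apply/setP => y.
  by have := CC (move_back cs y); rewrite !inE /f move_backK.
have [E|E] : (f @^-1: cluster1 P = cluster1 Q /\ f @^-1: cluster2 P = cluster2 Q) \/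
  (f @^-1: cluster1 P = cluster2 Q /\ f @^-1: cluster2 P = cluster1 Q).
  have [] := Qex _ (pre _ P1); have [] := Qex _ (pre _ P2).
  - by move=> <- /inj E; move: P12; rewrite E eqxx.
  - by left.
  - by right.
  - by move=> <- /inj E; move: P12; rewrite E eqxx.
- case: E => /setP E1 /setP E2.
  have M1 x : (move_piece cs x \in cluster1 P) = (x \in cluster1 Q).
    by rewrite -E1 inE.
  have M2 x : (move_piece cs x \in cluster2 P) = (x \in cluster2 Q).
    by rewrite -E2 inE.
  split; first by split=> //; left; split; exact: move_support.
  have L1 := move_cluster_lambda1 gs M1; have L2 := move_cluster_lambda1 gs M2.
  by move=> p; rewrite /LambdaD L1 L2.
- case: E => /setP E1 /setP E2.
  have M1 x : (move_piece cs x \in cluster1 P) = (x \in cluster2 Q).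
    by rewrite -E1 inE.
  have M2 x : (move_piece cs x \in cluster2 P) = (x \in cluster1 Q).
    by rewrite -E2 inE.
  split; first by split=> //; right; split; exact: move_support.
  have L1 := move_cluster_lambda1 gs M1; have L2 := move_cluster_lambda1 gs M2.
  move=> p; rewrite /LambdaD L1 L2.
  move: (cluster_lambda1 (cluster1 Q)) (cluster_lambda1 (cluster2 Q)) => l1 l2.
  case: p => [p||]; [|by rewrite maxC|by []].
  by rewrite [l2 `^ p + _]addrC.
Qed.

End StarCuts.

(** * The partitions at distance a from the centre *)

Lemma ord3_third (e1 e2 e e' : 'I_3) : e1 != e2 ->
  e != e1 -> e != e2 -> e' != e1 -> e' != e2 -> e = e'.
Proof.
move=> n n1 n2 n1' n2'; apply/val_inj.
case: e1 e2 e e' n n1 n2 n1' n2' => [[|[|[|]]]//? ] [[|[|[|]]]//?]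
  [[|[|[|]]]//?] [[|[|[|]]]//?] //=.
Qed.

Section StarClassification.
Variable R : realType.
Implicit Types (c : cut (star3 R)) (a : R).

Lemma adjacent_equiv c : equivalence_rel (@adjacent R (cut_graph c)).
Proof.
have trans (x y z : edge (cut_graph c)) :
    adjacent x y -> adjacent y z -> adjacent x z.
  by rewrite -!connect_adjacent; exact: connect_trans.
have sym (x y : edge (cut_graph c)) : adjacent x y -> adjacent y x.
  rewrite !adjacentE => /orP[/eqP ->|/and3P[-> -> xy]]; first by rewrite eqxx.
  have [xx /(_ xy)] := glue_equiv c (tag x, false) (tag y, false) (tag x, false).
  by have [-> _] := glue_equiv c (tag x, false) (tag x, false) (tag x, false);
    move=> <-; rewrite orbT.
move=> x y z; split; first by rewrite adjacentE eqxx.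
by move=> xy; apply/idP/idP; apply: trans => //; exact: sym.
Qed.

Lemma component_eq c (x y : edge (cut_graph c)) :
  adjacent x y -> finset (adjacent x) = finset (adjacent y).
Proof.
move=> xy; apply/setP => z; rewrite !inE.
by have [_ ->] := adjacent_equiv x y z.
Qed.

(** For a = 0 the three central ends represent the same point, which is why all
    of them appear. *)
Lemma cut_point_star a (e : 'I_3) t : 0 <= a < 1 ->
  cut_point (star_cut a) (e, t) <-> t = a /\ (a = 0 \/ e = ord0).
Proof.
move=> /andP[a_ge0 a_lt1]; split.
  case=> /=.
    rewrite /star_cuts; case: ifP => // /andP[/eqP -> _].
    by rewrite inE => /eqP ->; split=> //; right.
  case=> -[p b] [[p' b'] /= [[-> ->]]] v; rewrite /star_glue v /= negb_or.
  rewrite -leNgt => /andP[a_le0 pp'].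
  have a0 : a = 0 by apply/eqP; rewrite eq_le a_le0.
  split; last by left.
  move: v; rewrite /star_vtx /= => /orP[/eqP[pE]|].
    by move: pp'; rewrite pE eqxx.
  by rewrite negb_or /coord a0 => /andP[/negPf -> _].
case=> -> [a0|->].
  right; exists (e, false), ((if e == ord0 then lift ord0 ord0 else ord0), false).
  rewrite /= a0; split=> //; first by rewrite /star_vtx /= orbT.
  by rewrite /star_glue /star_vtx /= orbT ltxx /=; case: (eqVneq e ord0).
have [->|a_neq0] := eqVneq a 0.
  right; exists (ord0, false), (lift ord0 ord0, false); split=> //.
  by rewrite /= /star_glue /star_vtx /= ltxx.
by left; rewrite /= /star_cuts eqxx lt_neqAle eq_sym a_neq0 a_ge0 a_lt1 /= inE.
Qed.

Section StarPieces.
Variable a : R.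
Hypothesis a01 : 0 <= a < 1.

Lemma size_star_cuts (e : 'I_3) :
  size (cuts (star_cut a) e) = ((e == ord0) && (0 < a)).
Proof.
have /andP[_ a_lt1] := a01.
by rewrite /= /star_cuts a_lt1 andbT; case: ifP.
Qed.

Lemma star_piece_bound (x : piece (star_cut a)) :
  (tagged x <= ((tag x == ord0 :> 'I_3) && (0 < a)%R))%N.
Proof.
have := ltn_ord (tagged x); rewrite ltnS => /leq_trans; apply.
by rewrite size_star_cuts.
Qed.

Lemma in_star_G2 (x : edge (cut_graph (star_cut a))) : x \in star_G2 a =
  (tag x == ord0 :> 'I_3) && ((tagged x : nat) == (0 < a) :> nat).
Proof.
rewrite inE; apply: andb_id2l => x0; congr (_ == _).
by rewrite size_star_cuts x0.
Qed.

Lemma in_star_G1 (x : edge (cut_graph (star_cut a))) : x \in star_G1 a =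
  ((tagged x : nat) == 0%N) && ((0 < a) || (tag x != ord0 :> 'I_3)).
Proof.
rewrite inE in_star_G2.
have := star_piece_bound x.
by case: (tag x == ord0) (0 < a) => -[] /=; case: (tagged x : nat) => [|[]].
Qed.

Definition star_G1_piece : edge (cut_graph (star_cut a)) :=
  existT _ (lift ord0 ord0) ord0.
Definition star_G2_piece : edge (cut_graph (star_cut a)) :=
  existT _ ord0 ord_max.

Lemma star_G1_component : star_G1 a = finset (adjacent star_G1_piece).
Proof.
apply/setP => x; rewrite in_star_G1 inE adjacentE /= /star_glue /star_vtx /=.
have [<-|_] := eqVneq star_G1_piece x; first by rewrite /= orbT.
by rewrite !orbT /=; case: (tag x == ord0 :> 'I_3).
Qed.

Lemma star_G2_pieceE : (tagged star_G2_piece : nat) = (0 < a).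
Proof. exact: (size_star_cuts ord0). Qed.

Lemma star_G2_component : star_G2 a = finset (adjacent star_G2_piece).
Proof.
apply/setP => x; rewrite in_star_G2 inE adjacentE star_G2_pieceE.
apply/andP/orP => [[/eqP x0 /eqP xa]|[/eqP <-|/and3P[a0 x0]]].
- by left; apply/eqP/piece_eq; rewrite ?star_G2_pieceE ?xa ?x0.
- by rewrite star_G2_pieceE.
- rewrite /= /star_glue (eqP x0); case: (0 < a) a0 => //= _.
  by rewrite eqxx => /andP[_ /eqP <-].
Qed.

Lemma star_partition_exhaustive :
  partition2 (star_partition a) /\ exhaustive (star_partition a).
Proof.
split; first split.
- by apply/is_componentP; exists star_G1_piece; exact: star_G1_component.
- by apply/is_componentP; exists star_G2_piece; exact: star_G2_component.
- apply/negP => /eqP /setP /(_ star_G2_piece).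
  by rewrite inE; case: (_ \in _).
move=> C /is_componentP[x ->].
have [x2|] := boolP (x \in star_G2 a).
  right; rewrite [RHS]star_G2_component; apply/esym/component_eq.
  by move: x2; rewrite star_G2_component inE.
move=> x2; have x1 : x \in star_G1 a by rewrite /star_G1 finset.in_setC.
left; rewrite [RHS]star_G1_component; apply/esym/component_eq.
by move: x1; rewrite star_G1_component inE.
Qed.

Lemma star_G2_ends (x : piece (star_cut a)) :
  x \in star_G2 a -> piece_left x = a /\ piece_right x = 1.
Proof.
rewrite in_star_G2 => /andP[/eqP x0 /eqP xa]; have /andP[a_ge0 a_lt1] := a01.
rewrite /piece_left /piece_right xa x0 /= /star_cuts a_lt1 andbT eqxx /=.
case: ifPn => //; rewrite lt_neqAle a_ge0 andbT negbK => /eqP <-.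
by [].
Qed.

Lemma star_G1_ends (x : piece (star_cut a)) : x \in star_G1 a ->
  piece_left x = 0 /\ piece_right x = if tag x == ord0 :> 'I_3 then a else 1.
Proof.
rewrite in_star_G1 => /andP[/eqP x0 xa]; have /andP[a_ge0 a_lt1] := a01.
have nthE (e : edge (star3 R)) : nth 1 (star_cuts a e) 0 =
    if (e == ord0 :> 'I_3) && (0 < a) then a else 1.
  by rewrite /star_cuts a_lt1 andbT; case: ifP.
rewrite /piece_left /piece_right x0 /=; split=> //; rewrite nthE.
by move: xa; case: (tag x == ord0 :> 'I_3) => //; rewrite orbF => ->.
Qed.

Lemma same_point_interior (e e' : 'I_3) (t t' : R) : 0 < t < 1 ->
  @same_point R (star3 R) (e, t) (e', t') -> e = e' /\ t = t'.
Proof.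
move=> /andP[t0 t1] [[-> ->]//|[[p b] [p' [/= [_ tE] _ _]]]].
by move: t0 t1; rewrite tE /coord /=; case: b {tE}; rewrite ltxx.
Qed.

(** The cut point belongs to the support of G_2(a), and points outside that
    support are found arbitrarily close to it: towards the centre if a > 0, on
    another edge if a = 0. *)
Lemma star_partition_rigid : rigid (star_partition a).
Proof.
have /andP[a_ge0 a_lt1] := a01.
move=> [e t] /(cut_point_star _ _ a01)[-> ae]; right.
have e_in : support (star_G2 a) (e, a).
  have x2 : star_G2_piece \in star_G2 a.
    by rewrite in_star_G2 /= size_star_cuts !eqxx.
  exists star_G2_piece, a; split=> //=.
    by have [-> ->] := star_G2_ends x2; rewrite lexx ltW.
  case: ae => [a0|->]; last by left.
  by right; exists (e, false), (ord0, false); rewrite /= a0 /star_vtx /= orbT.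
split; first by rewrite /is_point /= a_ge0 ltW.
move=> W [Wp Wsat Wop] Wea; split; first by exists (e, a).
have nsupp (e' : 'I_3) (x : R) : 0 < x < 1 -> e' != ord0 \/ x < a ->
    ~ support (star_G2 a) (e', x).
  move=> x01 e'x [y [u [y2 yu yx]]].
  have [e'y xu] := same_point_interior x01 yx; subst u.
  have [yl _] := star_G2_ends y2; move: y2; rewrite in_star_G2 => /andP[/eqP y0 _].
  move: yu; rewrite yl => /andP[ax _].
  by case: e'x => [/eqP|]; [rewrite e'y y0|rewrite ltNge ax].
have [a0|a_gt0] : a = 0 \/ 0 < a.
  by move: a_ge0; rewrite le_eqVlt => /orP[/eqP <-|]; [left|right].
- pose e1 : edge (star3 R) := lift ord0 ord0.
  have W1 : W (e1, a).
    apply: Wsat Wea; right; exists (e, false), (e1, false).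
    by rewrite a0 /= /star_vtx /= orbT.
  have [V Vop WV] := Wop e1.
  have Va : V a by apply/WV => //=; rewrite a_ge0 ltW.
  have [d /= d_gt0 dV] := Vop _ Va.
  pose x := Num.min (d / 2) (1 / 2).
  have x_gt0 : 0 < x by rewrite lt_min !divr_gt0.
  have x_lt1 : x < 1 by rewrite gt_min; apply/orP; right; lra.
  have x_d : x < d by rewrite gt_min; apply/orP; left; lra.
  exists (e1, x); last by apply: nsupp => //; [rewrite x_gt0|left].
  apply/WV; first by rewrite /= !ltW.
  by apply: dV; rewrite /ball /= a0 sub0r normrN gtr0_norm.
- have e_eq0 : e = ord0 by case: ae => // a0; move: a_gt0; rewrite a0 ltxx.
  have [V Vop WV] := Wop e.
  have Va : V a by apply/WV => //=; rewrite a_ge0 ltW.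
  have [d /= d_gt0 dV] := Vop _ Va.
  pose x := Num.max (a / 2) (a - d / 2).
  have x_gt0 : 0 < x by rewrite lt_max divr_gt0.
  have x_lta : x < a by rewrite gt_max; apply/andP; split; lra.
  have x_d : a - d < x by rewrite lt_max; apply/orP; right; lra.
  have x_lt1 : x < 1 by exact: lt_trans a_lt1.
  exists (e, x); last by apply: nsupp => //; [rewrite x_gt0|right].
  apply/WV; first by rewrite /= !ltW.
  by apply: dV; rewrite /ball /= gtr0_norm ?subr_gt0// ltrBlDr -ltrBlDl.
Qed.

End StarPieces.

Lemma star_partition_exhaustive_rigid a : 0 <= a < 1 ->
  exhaustive_rigid_partition (star_partition a).
Proof.
move=> a01; have [? ?] := star_partition_exhaustive a01.
by split=> //; exact: star_partition_rigid.
Qed.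

End StarClassification.

(** * Classification of the exhaustive 2-partitions *)

Section StarClassificationConverse.
Variable R : realType.
Variable P : cluster_pair (star3 R).
Hypothesis P2 : partition2 P.
Hypothesis Pex : exhaustive P.
Let c := pcut P.

(** The pigeonhole principle behind the classification. *)
Lemma no_three_components (x y z : edge (cut_graph c)) :
  ~~ adjacent x y -> ~~ adjacent x z -> ~~ adjacent y z -> False.
Proof.
have comp w : finset (adjacent w) = cluster1 P \/ finset (adjacent w) = cluster2 P.
  by apply: Pex; apply/is_componentP; exists w.
have eqC (u v : edge (cut_graph c)) : finset (adjacent u) = finset (adjacent v) -> adjacent u v.
  move=> /setP /(_ v); rewrite !inE => ->.
  by have [] := adjacent_equiv v v v.
move=> /negP xy /negP xz /negP yz.
case: (comp x) (comp y) (comp z) => ex [] ey [] ez;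
  first [ by case: xy; apply: eqC; exact: etrans ex (esym ey)
        | by case: xz; apply: eqC; exact: etrans ex (esym ez)
        | by case: yz; apply: eqC; exact: etrans ey (esym ez)].
Qed.

Lemma two_components : exists x y : edge (cut_graph c), ~~ adjacent x y.
Proof.
case: P2 => /is_componentP[x Cx] /is_componentP[y Cy] C12.
exists x, y; apply: contra C12 => xy.
by apply/eqP; rewrite Cx Cy; exact: component_eq.
Qed.

Let first (e : 'I_3) : edge (cut_graph c) := existT _ e ord0.

Let glued (e e' : 'I_3) := glue c (e, false) (e', false).

Lemma first_adjacent e e' : adjacent (first e) (first e') = glued e e'.
Proof.
rewrite adjacentE /= orb_idl// => /eqP [->].
by have [] := glue_equiv c (e', false) (e', false) (e', false).
Qed.

Lemma inner_adjacent (x y : edge (cut_graph c)) : (tagged x : nat) != 0%N ->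
  adjacent x y = (x == y).
Proof. by move=> /negPf x0; rewrite adjacentE x0 /= orbF. Qed.

(** A piece off the centre is a component by itself, so a second such piece, or
    a split centre, would produce a third component. *)
Lemma classification_severed (y : edge (cut_graph c)) :
  (tagged y : nat) != 0%N ->
  exists a : R, [/\ 0 < a < 1,
    forall e : 'I_3, cuts c e = if e == tag y then [:: a] else [::]
    & forall e e', glued e e'].
Proof.
move=> y0.
have uniq_inner (x : edge (cut_graph c)) : (tagged x : nat) != 0%N -> y = x.
  move=> x0; apply/eqP/negPn/negP => yx.
  have f0 (z : edge (cut_graph c)) : (tagged z : nat) != 0%N -> z != first ord0.
    by apply: contra => /eqP ->.
  by apply: (@no_three_components y x (first ord0)); rewrite inner_adjacent ?f0.
have outer e : (0 < size (cuts c e))%N -> e = tag y /\ size (cuts c e) = 1%N.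
  move=> s0.
  have ymax : y = existT _ e ord_max by apply: uniq_inner; rewrite /= -lt0n.
  have y1 : y = existT _ e (Ordinal (n := (size (cuts c e)).+1) (m := 1) s0).
    exact: uniq_inner.
  split; first by rewrite ymax.
  have := congr1 (fun z : piece c => (tagged z : nat)) y1.
  by rewrite [in LHS]ymax.
have sy : (0 < size (cuts c (tag y)))%N.
  by have := ltn_ord (tagged y); rewrite ltnS; apply: leq_trans; rewrite lt0n.
have [_ sy1] := outer _ sy.
move: (cuts_sorted c (tag y)).
case E : (cuts c (tag y)) sy1 => [|a [|]]//= _ /and3P[a0 a1 _].
exists a; rewrite a0 a1; split=> // [e|e e'].
  case: eqVneq => [->//|ey]; apply/eqP; rewrite -size_eq0 -leqn0 leqNgt.
  by apply: contra ey => /outer[->].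
apply/negPn/negP => ee'.
have yf e1 : ~~ adjacent y (first e1).
  by rewrite inner_adjacent//; apply/negP => /eqP yE; move: y0; rewrite yE.
by apply: (@no_three_components y (first e) (first e')) => //;
  rewrite first_adjacent.
Qed.

Lemma glued_equiv : equivalence_rel glued.
Proof. by move=> e e' e''; exact: glue_equiv. Qed.

(** An equivalence relation on three points with exactly two classes isolates
    one of the points. *)
Lemma classification_central :
  (forall x : edge (cut_graph c), (tagged x : nat) = 0%N) ->
  (forall e, cuts c e = [::]) /\
  exists e0 : 'I_3, forall e e', glued e e' = ((e == e0) == (e' == e0)).
Proof.
move=> inner0; split=> [e|].
  by apply: size0nil; exact: (inner0 (existT _ e ord_max)).
have firstE (x : edge (cut_graph c)) : x = first (tag x).
  by apply: piece_eq; rewrite ?inner0.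
have [x [y]] := two_components; rewrite (firstE x) (firstE y) first_adjacent.
move: (tag x) (tag y) => e1 e2 e12.
have grefl e : glued e e by have [] := glued_equiv e e e.
have gsym1 e e' : glued e e' -> glued e' e.
  by move=> g; have [_ /(_ g) h] := glued_equiv e e' e; rewrite -h grefl.
have gsym e e' : glued e e' = glued e' e by apply/idP/idP; exact: gsym1.
have gtrans e e' e'' : glued e e' -> glued e' e'' -> glued e e''.
  by move=> g; have [_ /(_ g) ->] := glued_equiv e e' e''.
have n12 : e1 != e2 by apply: contra e12 => /eqP ->.
have isolated : exists e0, forall e, e != e0 -> ~~ glued e0 e.
  have [[e]|no] := pselect (exists e, (e != e1) && glued e1 e).
    move=> /andP[ne1 g1]; exists e2 => e' ne2; apply/negP => g2.
    have n1 : e' != e1 by apply: contra e12 => /eqP <-; rewrite gsym.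
    have n2 : e != e2 by apply: contra e12 => /eqP <-.
    have ee := ord3_third n12 ne1 n2 n1 ne2; subst e'.
    by move: e12; rewrite (gtrans _ _ _ g1)// gsym.
  by exists e1 => e ne; apply/negP => g; apply: no; exists e; rewrite ne.
case: isolated => e0 iso; exists e0 => e e'.
case: (eqVneq e e0) => [->|ne]; case: (eqVneq e' e0) => [->|ne'].
- exact: grefl.
- exact/negbTE/iso.
- by rewrite gsym; exact/negbTE/iso.
- apply/negPn/negP => g.
  by apply: (@no_three_components (first e0) (first e) (first e'));
    rewrite first_adjacent// iso.
Qed.

Lemma star_classification : exists (a : R) (s : {perm 'I_3}), [/\ 0 <= a < 1,
  forall e : 'I_3, cuts c (s e) = cuts (star_cut a) e
  & forall p q : 'I_3 * bool,
      glue c (s p.1, p.2) (s q.1, q.2) = glue (star_cut a) p q].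
Proof.
have tE (e0 e : 'I_3) : (tperm ord0 e0 e == e0) = (e == ord0).
  by rewrite -{2}(tpermL ord0 e0) (inj_eq perm_inj).
have glueE a e0 : (forall e e', glued (tperm ord0 e0 e) (tperm ord0 e0 e') =
      (0 < a) || ((e == ord0) == (e' == ord0))) ->
    forall p q : 'I_3 * bool, glue c (tperm ord0 e0 p.1, p.2) (tperm ord0 e0 q.1, q.2)
      = glue (star_cut a) p q.
  move=> gl [e b] [e' b']; rewrite /= /star_glue /star_vtx /=.
  have [bb'|] := boolP (b || b').
    rewrite glue_outer// orbF !xpair_eqE (inj_eq perm_inj).
    by case: (eqVneq e e') => [->|]//=; rewrite eqxx orbT andbT.
  by rewrite negb_or => /andP[/negPf -> /negPf ->]; rewrite orbT; exact: gl.
have [[y y0]|inner0] :=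
    pselect (exists y : edge (cut_graph c), (tagged y : nat) != 0%N).
  have [a [/andP[a0 a1] cE gE]] := classification_severed y0.
  exists a, (tperm ord0 (tag y)); split.
  - by rewrite ltW.
  - by move=> e; rewrite cE tE /= /star_cuts a0 a1 !andbT.
  - by apply: glueE => e e'; rewrite gE a0.
have {inner0} : forall y : edge (cut_graph c), (tagged y : nat) = 0%N.
  move=> y; apply/eqP/negPn/negP => y0; apply: inner0; by exists y.
move=> /classification_central[cE [e0 gE]].
exists 0, (tperm ord0 e0); split.
- by rewrite lexx ltr01.
- by move=> e; rewrite cE /= /star_cuts ltxx andbF.
- by apply: glueE => e e'; rewrite gE !tE ltxx.
Qed.

End StarClassificationConverse.

Lemma star_partition_LambdaD (R : realType) (P : cluster_pair (star3 R)) :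
  exhaustive_rigid_partition P ->
  exists a : R, [/\ 0 <= a < 1,
    exists s : {perm 'I_3}, star_symmetric s P (star_partition a)
    & forall p, LambdaD p P = LambdaD p (star_partition a)].
Proof.
move=> [P2 Pex _]; have [a [s [a01 cs gs]]] := star_classification P2 Pex.
have [Q2 Qex] := star_partition_exhaustive a01.
have [sym L] := star_symmetric_partition P2 Pex Q2 Qex cs gs.
by exists a; split=> //; exists s.
Qed.

Lemma star_symmetric_inj (R : realType) (P : cluster_pair (star3 R)) (a a' : R)
    (s s' : {perm 'I_3}) : 0 <= a < 1 -> 0 <= a' < 1 ->
  star_symmetric s P (star_partition a) ->
  star_symmetric s' P (star_partition a') -> a = a'.
Proof.
have half b b' (r r' : {perm 'I_3}) : 0 < b < 1 ->
    star_symmetric r P (star_partition b) ->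
    star_symmetric r' P (star_partition b') -> b = b'.
  move=> b01 [cb _ _] [cb' _ _].
  have := cb' (r'^-1%g (r ord0)); rewrite permKV cb /= /star_cuts eqxx b01 /=.
  by case: ifP => // _ [].
move=> /andP[a0 a1] /andP[a0' a1'] sa sa'.
have [a_le0|a_gt0] := leP a 0; last by apply: (half _ _ _ _ _ sa sa'); rewrite a_gt0.
have [a_le0'|a_gt0'] := leP a' 0.
  by apply/le_anti; rewrite (le_trans a_le0 a0') (le_trans a_le0' a0).
by apply/esym; apply: (half _ _ _ _ _ sa' sa); rewrite a_gt0'.
Qed.

(** * Ground states of the two clusters *)

Section GroundStates.
Variable R : realType.
Implicit Types (a k m x : R).

(** The general solution of - f'' = m^2 f for m <> 0, by its coefficients
    A and B. *)
Definition oscillation (A B m x : R) : R := A * cos (m * x) + B * sin (m * x).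

Definition oscillation' (A B m x : R) : R :=
  m * (B * cos (m * x) - A * sin (m * x)).

Lemma is_derive_oscillation A B m x :
  is_derive x 1 (oscillation A B m) (oscillation' A B m x).
Proof.
have Dm := der_scale m (der_id x).
have Dc := der_comp Dm (is_derive_cos (m * x)).
have Ds := der_comp Dm (is_derive_sin (m * x)).
apply: der_eq (der_add (der_scale A Dc) (der_scale B Ds)) _.
by rewrite /oscillation'; lra.
Qed.

Lemma is_derive_oscillation' A B m x :
  is_derive x 1 (oscillation' A B m) (- (m ^+ 2 * oscillation A B m x)).
Proof.
have Dm := der_scale m (der_id x).
have Dc := der_comp Dm (is_derive_cos (m * x)).
have Ds := der_comp Dm (is_derive_sin (m * x)).
apply: der_eq (der_scale m (der_sub (der_scale B Dc) (der_scale A Ds))) _.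
by rewrite /oscillation; lra.
Qed.

Lemma oscillation0 A B m : oscillation A B m 0 = A.
Proof. by rewrite /oscillation mulr0 cos0 sin0 mulr1 mulr0 addr0. Qed.

Lemma oscillation'0 A B m : oscillation' A B m 0 = m * B.
Proof. by rewrite /oscillation' mulr0 cos0 sin0 mulr1 mulr0 subr0. Qed.

Lemma oscillation_cos L m x :
  oscillation (cos (m * L)) (sin (m * L)) m x = cos (m * (L - x)).
Proof. by rewrite mulrBr cosB. Qed.

Lemma oscillation'_cos L m :
  oscillation' (cos (m * L)) (sin (m * L)) m L = 0.
Proof. by rewrite /oscillation'; lra. Qed.

Section Cluster.
Variable a : R.
Hypothesis a01 : 0 <= a < 1.

Lemma star_G2_lambda1 :
  cluster_lambda1 (star_G2 a) = (pi / (2 * (1 - a))) ^+ 2.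
Proof.
have /andP[a_ge0 a_lt1] := a01.
pose L := 1 - a; have L_gt0 : 0 < L by rewrite subr_gt0.
set k := pi / _.
have kL : k * L = pi / 2.
  rewrite /k -/L invfM mulrA mulfVK ?gt_eqF//.
have k_gt0 : 0 < k by rewrite divr_gt0 ?pi_gt0// mulr_gt0.
pose S := subgraph (star_G2 a).
have lenE (e : edge S) : len e = L.
  by rewrite /= /piece_len; have [-> ->] := star_G2_ends a01 (valP e).
have coordE (p : endpoint S) : coord p = if p.2 then L else 0.
  by rewrite /coord lenE.
have e_uniq (e e' : edge S) : e = e'.
  apply/val_inj/piece_eq; have := valP e; have := valP e';
  rewrite !in_star_G2// => /andP[/eqP t' /eqP i'] /andP[/eqP t /eqP i].
    by rewrite t t'.
  by rewrite i i'.
have vtxE (p q : endpoint S) : vtx p q = (p == q).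
  case: p q => [e b] [e' b']; rewrite (e_uniq e' e) [vtx _ _]piece_vtxE.
  rewrite !xpair_eqE !eqxx /=; by case: b; case: b'.
have DE (p : endpoint S) : cluster_dirichlet p <-> p.2 = false.
  have [le re] := star_G2_ends a01 (valP p.1).
  have := valP p.1; rewrite in_star_G2// => /andP[/eqP t0 _].
  rewrite /cluster_dirichlet /= le re cut_point_star//; case: p.2.
    by split=> // -[/esym/eqP]; rewrite lt_eqF.
  by split=> // _; split=> //; right.
apply: (@lambda1_ground_state R S _ k
  (fun m _ => oscillation (cos (m * L)) (sin (m * L)) m)
  (fun m _ => oscillation' (cos (m * L)) (sin (m * L)) m)) => //.
- move=> m e x; exact: is_derive_oscillation.
- move=> m e x; exact: is_derive_oscillation'.
- by move=> m p q; rewrite vtxE => /eqP ->.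
- move=> m [e b] nD.
  have -> : b = true by apply: contra_notT nD => /negbTE bf; apply/DE.
  rewrite (big_pred1 (e, true)) => [|q]; last by rewrite vtxE eq_sym.
  by rewrite coordE /= oscillation'_cos mulr0.
- move=> m e x /andP[m_gt0 mk] /andP[x_ge0]; rewrite lenE => xL.
  rewrite oscillation_cos; apply: cos_gt0_pihalf; apply/andP; split.
    rewrite (@lt_le_trans _ _ 0) ?oppr_lt0 ?divr_gt0 ?pi_gt0//.
    by rewrite mulr_ge0 ?subr_ge0// ltW.
  rewrite -kL; apply: (@le_lt_trans _ _ (m * L)).
    by rewrite ler_pM2l// gerBl.
  by rewrite ltr_pM2r.
- move=> [e b] /DE /= ->; rewrite coordE /= oscillation0 kL cos_pihalf//.
- have x2 : star_G2_piece a \in star_G2 a.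
    by rewrite in_star_G2// star_G2_pieceE// eqxx.
  exists (exist (fun y => is_true (y \in star_G2 a)) _ x2), L; rewrite lenE lexx ltW// oscillation_cos subrr mulr0.
  by rewrite cos0 oner_eq0.
Qed.

(** On every edge the coefficient A = cos m ensures continuity at the centre.
    B = sin m makes the outer ends of the uncut edges free, and B = - 2 sin m
    on the severed edge restores the Kirchhoff condition.  For m < k all the
    factors of cos k cos (k a) = 2 sin k sin (k a) move in the direction that
    makes the solution positive up to the cut. *)
Lemma star_G1_lambda1 k : 0 < k -> k <= pi / 2 ->
  2 * (sin k * sin (k * a)) = cos k * cos (k * a) ->
  cluster_lambda1 (star_G1 a) = k ^+ 2.
Proof.
move=> k_gt0 k_le keq; have /andP[a_ge0 a_lt1] := a01.
pose S := subgraph (star_G1 a).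
pose tg (e : edge S) : 'I_3 := tag (val e).
have idx0 (e : edge S) : (tagged (val e) : nat) = 0%N.
  by have := valP e; rewrite in_star_G1// => /andP[/eqP].
have tg0 (e : edge S) : tg e = ord0 -> 0 < a.
  by have := valP e; rewrite in_star_G1// /tg => /andP[_ /orP[//|/eqP]].
have leftE (e : edge S) : piece_left (val e) = 0.
  by have [] := star_G1_ends a01 (valP e).
have rightE (e : edge S) : piece_right (val e) = if tg e == ord0 then a else 1.
  by have [] := star_G1_ends a01 (valP e).
have lenE (e : edge S) : len e = if tg e == ord0 then a else 1.
  by rewrite /= /piece_len leftE rightE subr0.
have coordE (p : endpoint S) :
    coord p = if p.2 then if tg p.1 == ord0 then a else 1 else 0.
  by rewrite /coord lenE.
have e_uniq (e e' : edge S) : tg e = tg e' -> e = e'.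
  by move=> tt; apply/val_inj/piece_eq => //; rewrite !idx0.
have vtxE (p q : endpoint S) : vtx p q = (p == q) || [&& ~~ p.2, ~~ q.2
    & (0 < a) || ((tg p.1 == ord0) == (tg q.1 == ord0))].
  case: p q => [e b] [e' b']; rewrite [vtx _ _]piece_vtxE.
  rewrite !xpair_eqE (inj_eq val_inj) /= !idx0 /= /star_glue /star_vtx /=.
  by rewrite orbT.
have DE (p : endpoint S) : cluster_dirichlet p <->
    if p.2 then tg p.1 = ord0 else a = 0.
  rewrite /cluster_dirichlet /= leftE rightE cut_point_star//; case: p.2.
    case: (eqVneq (tg p.1) ord0) => [t0|tn].
      by split=> // _; split=> //; right.
    by split=> [[/esym/eqP]|t0]; [rewrite lt_eqF|move: tn; rewrite t0 eqxx].
  split=> [[a0 _]|a0]; first exact: esym.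
  by split; [exact: esym | left].
pose B m (e : 'I_3) := if e == ord0 then - (2 * sin m) else sin m.
have end1 m (e : edge S) : tg e != ord0 ->
    oscillation' (cos m) (B m (tg e)) m 1 = 0.
  by move=> /negPf tn; rewrite /B tn -[X in cos X]mulr1 -[X in sin X]mulr1
    oscillation'_cos.
apply: (@lambda1_ground_state R S _ k
  (fun m e => oscillation (cos m) (B m (tg e)) m)
  (fun m e => oscillation' (cos m) (B m (tg e)) m)) => //.
- move=> m e x; exact: is_derive_oscillation.
- move=> m e x; exact: is_derive_oscillation'.
- move=> m p q; rewrite vtxE => /orP[/eqP ->//|/and3P[/negPf pb /negPf qb _]].
  by rewrite !coordE pb qb !oscillation0.
- move=> m [e []] nD.
    have tn : tg e != ord0 by apply/eqP => t0; apply: nD; apply/DE.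
    rewrite (big_pred1 (e, true)) => [|q]; last by rewrite vtxE /= orbF eq_sym.
    by rewrite coordE /= (negPf tn) end1// mulr0.
  have an0 : a != 0 by apply/eqP => a0; apply: nD; apply/DE.
  have a_gt0 : 0 < a by rewrite lt_neqAle eq_sym an0.
  have eP (i : 'I_3) : (existT _ i ord0 : piece (star_cut a)) \in star_G1 a.
    by rewrite in_star_G1//= a_gt0.
  rewrite (eq_bigl (fun q : endpoint S => predT q.1 && (q.2 == false))); last first.
    move=> [e' b']; rewrite vtxE a_gt0 /= andbT.
    by case: b'; rewrite ?orbT// orbF xpair_eqE andbF.
  rewrite -(pair_big xpredT (fun b => b == false)
    (fun e b => (if b then -1 else 1) *
       oscillation' (cos m) (B m (tg e)) m (coord (e, b)))) /=.
  under eq_bigr do rewrite big_pred1_eq mul1r coordE /= oscillation'0.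
  rewrite -(reindex tg (P := xpredT) (F := fun i => m * B m i)) /=; last first.
    apply: onW_bij; exists (fun i => exist (fun y => is_true (y \in star_G1 a)) _ (eP i)) => [e'|i//].
    exact: e_uniq.
  rewrite !big_ord_recl big_ord0 /B /=; lra.
- move=> m e x /andP[m_gt0 mk] /andP[x_ge0]; rewrite lenE /B.
  have pi2_le : pi / 2 <= pi :> R by have := pi_gt0 R; lra.
  case: eqVneq => [_ xa|_ x_le1]; last first.
    have := oscillation_cos 1 m x; rewrite mulr1 => ->.
    apply: cos_gt0_pihalf; apply/andP; split.
      rewrite (@lt_le_trans _ _ 0) ?oppr_lt0 ?divr_gt0 ?pi_gt0//.
      by rewrite mulr_ge0 ?subr_ge0// ltW.
    apply: lt_le_trans k_le; apply: le_lt_trans mk.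
    by rewrite -[leRHS]mulr1 ler_pM2l// gerBl.
  have cosk : 0 <= cos k by apply: cos_ge0_pihalf; lra.
  have mx_ge0 : 0 <= m * x by rewrite mulr_ge0// ltW.
  have mx_le : m * x <= k * a by rewrite ler_pM// ltW.
  have ka_lt : k * a < pi / 2.
    apply: lt_le_trans k_le; by rewrite -[ltRHS]mulr1 ltr_pM2l.
  have coska : 0 < cos (k * a) by apply: cos_gt0_pihalf; lra.
  have cosm : cos k < cos m by rewrite ltr_cos// in_itv /=; lra.
  have cosmx : cos (k * a) <= cos (m * x).
    by rewrite leNgt ltr_cos -?leNgt// in_itv /=; lra.
  have sinm : sin m <= sin k.
    by rewrite leNgt ltr_sin -?leNgt ?ltW// in_itv /=; lra.
  have sinmx : sin (m * x) <= sin (k * a).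
    by rewrite leNgt ltr_sin -?leNgt// in_itv /=; lra.
  have sinm0 : 0 <= sin m by apply: sin_ge0_pi; lra.
  have sinmx0 : 0 <= sin (m * x) by apply: sin_ge0_pi; lra.
  have h1 := ler_pM sinm0 sinmx0 sinm sinmx.
  have h2 : cos m * cos (k * a) <= cos m * cos (m * x) by apply: ler_wpM2l => //; lra.
  have h3 : cos k * cos (k * a) < cos m * cos (k * a) by rewrite ltr_pM2r.
  by rewrite /oscillation; lra.
- move=> p /DE; rewrite coordE; case: p.2 => [t0|a0].
    by rewrite t0 eqxx /oscillation /B eqxx; lra.
  by move: keq; rewrite oscillation0 a0 mulr0 sin0 cos0; lra.
- have x1 : star_G1_piece a \in star_G1 a by rewrite in_star_G1//= orbT.
  exists (exist (fun y => is_true (y \in star_G1 a)) _ x1), 1; split; first by rewrite lenE /= ler01 lexx.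
  rewrite /B /=; have := oscillation_cos 1 k 1; rewrite mulr1 => ->.
  by rewrite subrr mulr0 cos0 oner_eq0.
Qed.

End Cluster.
End GroundStates.

(** * The cut position as a function of the frequency *)

Section Profile.
Variable R : realType.
Implicit Types (k x y p : R).

Lemma der_lt (f df : R -> R) x y : x < y ->
  (forall z, x <= z <= y -> is_derive z 1 f (df z)) ->
  (forall z, x < z < y -> 0 < df z) -> f x < f y.
Proof.
move=> xy Df df_gt0.
have [z||z /andP[]] := @MVT _ f df x y xy.
- by move=> /andP[]; rewrite !bnd_simp => xz zy; apply: Df; rewrite !ltW.
- apply: derivable_within_continuous => z /andP[]; rewrite !bnd_simp => xz zy.
  by have [] := Df z; rewrite ?xz ?zy.
rewrite !bnd_simp => xz zy fE.
by rewrite -subr_gt0 fE mulr_gt0 ?subr_gt0// df_gt0// xz zy.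
Qed.

(** The distance a for which k is the ground frequency of G_1(a). *)
Definition cut_position k : R := atan (cos k / sin k / 2) / k.

(** The opposite of the derivative of [cut_position]. *)
Definition cut_speed k : R := (2 / (1 + 3 * sin k ^+ 2) + cut_position k) / k.

(** The opposite of the derivative of [cut_speed]. *)
Definition cut_accel k : R :=
  (12 * (sin k * cos k) / (1 + 3 * sin k ^+ 2) ^+ 2 + 2 * cut_speed k) / k.

Lemma is_derive_cut_position k : 0 < k < pi ->
  is_derive k 1 cut_position (- cut_speed k).
Proof.
move=> /andP[k_gt0 k_lt].
have s_gt0 : 0 < sin k by apply: sin_gt0_pi; rewrite k_gt0.
have s_neq0 := lt0r_neq0 s_gt0.
have Dq := der_mul (der_mul (is_derive_cos k) (der_inv (is_derive_sin k) s_neq0))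
  (der_cst 2^-1 k).
have Da := der_comp Dq (is_derive1_atan _).
apply: der_eq (der_mul Da (der_inv (der_id k) (lt0r_neq0 k_gt0))) _.
rewrite /cut_speed /cut_position.
move: (atan _) => A; rewrite !mul1r.
set q := 1 + 3 * sin k ^+ 2.
have q_gt0 : 0 < q by rewrite ltr_pwDl// mulr_ge0// sqr_ge0.
set i := (sin k)^-1; have si : sin k * i = 1 by rewrite mulfV.
have cs : cos k ^+ 2 = 1 - sin k ^+ 2 by rewrite cos2sin2.
have i2 : sin k ^+ 2 * i ^+ 2 = 1 by rewrite -exprMn si expr1n.
have -> : (1 + (cos k * i / 2) ^+ 2) = i ^+ 2 * q / 4.
  have -> : (cos k * i / 2) ^+ 2 = cos k ^+ 2 * i ^+ 2 / 4 by lra.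
  by rewrite cs /q; lra.
have d_neq0 : i ^+ 2 * q / 4 != 0.
  by rewrite gt_eqF// divr_gt0// mulr_gt0// exprn_gt0// invr_gt0.
rewrite (_ : (_ + _ * 0) = i ^+ 2 * q / 4 * - (2 / q)); last first.
  have -> : i ^+ 2 * q / 4 * - (2 / q) = - (i ^+ 2 / 2) * (q / q) by lra.
  rewrite divff ?gt_eqF// -exprVn -/i.
  have -> : cos k * - (cos k * i ^+ 2) = - (cos k ^+ 2 * i ^+ 2) by lra.
  rewrite cs; lra.
rewrite mulKf//.
have kk : k / k = 1 by rewrite divff ?gt_eqF.
rewrite -exprVn; lra.
Qed.

Lemma is_derive_cut_speed k : 0 < k < pi ->
  is_derive k 1 cut_speed (- cut_accel k).
Proof.
move=> k0pi; have /andP[k_gt0 k_lt] := k0pi.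
have q_gt0 : 0 < 1 + 3 * sin k ^+ 2 by rewrite ltr_pwDl// mulr_ge0// sqr_ge0.
have Dq := der_add (der_cst 1 k)
  (der_scale 3 (der_mul (is_derive_sin k) (is_derive_sin k))).
have Dr := der_scale 2 (der_inv Dq (lt0r_neq0 q_gt0)).
apply: der_eq (der_mul (der_add Dr (is_derive_cut_position k0pi))
  (der_inv (der_id k) (lt0r_neq0 k_gt0))) _.
rewrite /cut_accel -!expr2 [in RHS]/cut_speed.
have -> : 1 / k ^+ 2 = k^-1 * k^-1 by rewrite -exprVn expr2 mul1r.
rewrite /cut_speed; lra.
Qed.

Lemma pihalf_lt_pi : pi / 2 < pi :> R.
Proof. by have := pi_gt0 R; lra. Qed.

Lemma cut_position_ge0 k : 0 < k <= pi / 2 -> 0 <= cut_position k.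
Proof.
move=> /andP[k_gt0 k_le]; have pp := pihalf_lt_pi.
rewrite divr_ge0 ?(ltW k_gt0)// -[X in X <= _]atan0 le_atan//.
rewrite !mulr_ge0// ?invr_ge0//.
  by apply: cos_ge0_pihalf; lra.
by apply/ltW/sin_gt0_pi; lra.
Qed.

Lemma cut_speed_gt0 k : 0 < k <= pi / 2 -> 0 < cut_speed k.
Proof.
move=> kI; have /andP[k_gt0 _] := kI.
rewrite divr_gt0// ltr_wpDr ?cut_position_ge0// divr_gt0//.
by rewrite ltr_pwDl// mulr_ge0// sqr_ge0.
Qed.

Lemma cut_accel_gt0 k : 0 < k <= pi / 2 -> 0 < cut_accel k.
Proof.
move=> kI; have /andP[k_gt0 k_le] := kI; have pp := pihalf_lt_pi.
have b_gt0 := cut_speed_gt0 kI.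
rewrite divr_gt0// ltr_wpDl//; last by rewrite mulr_gt0.
have s_ge0 : 0 <= sin k by apply: sin_ge0_pi; lra.
have c_ge0 : 0 <= cos k by apply: cos_ge0_pihalf; lra.
by rewrite divr_ge0 ?sqr_ge0// !mulr_ge0.
Qed.

Lemma cut_position_lt x y : 0 < x -> x < y -> y <= pi / 2 ->
  cut_position y < cut_position x.
Proof.
move=> x_gt0 xy y_le; have pp := pihalf_lt_pi; rewrite -ltrN2.
apply: (@der_lt (fun z => - cut_position z) cut_speed) => // z zI.
  have Dz : is_derive z 1 cut_position (- cut_speed z).
    by apply: is_derive_cut_position; lra.
  by apply: der_eq (der_opp Dz) _; rewrite opprK.
by apply: cut_speed_gt0; lra.
Qed.

Lemma cut_position_pihalf : cut_position (pi / 2) = 0.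
Proof. by rewrite /cut_position cos_pihalf !mul0r atan0 mul0r. Qed.

(** The frequency at which the cut reaches the outer end of the edge. *)
Definition kmin : R := atan (Num.sqrt 2)^-1.

Lemma kmin_gt0 : 0 < kmin.
Proof. by rewrite -[X in X < _]atan0 lt_atan// invr_gt0 sqrtr_gt0. Qed.

Lemma kmin_lt : kmin < pi / 2.
Proof. exact: atan_ltpi2. Qed.

Lemma cut_position_kmin : cut_position kmin = 1.
Proof.
have k_gt0 := kmin_gt0; have k_lt := kmin_lt.
have c_gt0 : 0 < cos kmin by apply: cos_gt0_pihalf; lra.
have s2 : 0 < Num.sqrt 2 :> R by rewrite sqrtr_gt0.
have t : sin kmin / cos kmin = (Num.sqrt 2)^-1 by rewrite -[LHS]/(tan _) atanK.
rewrite /cut_position -[cos kmin / sin kmin]invf_div t invrK.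
have -> : Num.sqrt 2 / 2 = (Num.sqrt 2)^-1 :> R.
  by rewrite -{2}(@sqr_sqrtr R 2)// expr2 invfM mulrA mulfV ?mul1r// gt_eqF.
by rewrite -/kmin divff// gt_eqF.
Qed.

Lemma cut_position_in k : kmin < k <= pi / 2 -> 0 <= cut_position k < 1.
Proof.
move=> /andP[k_gt k_le]; have k0 := kmin_gt0.
rewrite cut_position_ge0; last by lra.
by rewrite -cut_position_kmin cut_position_lt.
Qed.

Lemma cut_position_surj y : 0 <= y < 1 ->
  exists2 k, kmin < k <= pi / 2 & cut_position k = y.
Proof.
move=> /andP[y0 y1]; have k0 := kmin_gt0; have k1 := kmin_lt; have pp := pihalf_lt_pi.
have [||k /andP[]] := @IVT R cut_position kmin (pi / 2) y (ltW k1).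
- apply: derivable_within_continuous => z /andP[]; rewrite !bnd_simp => z0 z1.
  have [|//] := @is_derive_cut_position z _; lra.
- rewrite cut_position_kmin cut_position_pihalf min_r// max_l//.
  by rewrite y0 ltW.
rewrite !bnd_simp => kk k_le kE; exists k => //; rewrite k_le andbT lt_neqAle kk.
by rewrite andbT; apply: contraTneq y1 => kE'; rewrite -kE -kE' cut_position_kmin ltxx.
Qed.

Lemma cut_position_eq k : 0 < k <= pi / 2 ->
  2 * (sin k * sin (k * cut_position k)) = cos k * cos (k * cut_position k).
Proof.
move=> kI; have /andP[k_gt0 k_le] := kI; have pp := pihalf_lt_pi.
have s_gt0 : 0 < sin k by apply: sin_gt0_pi; lra.
rewrite /cut_position; set y := _ / 2.
have -> : k * (atan y / k) = atan y by rewrite mulrC divfK// gt_eqF.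
have c_neq0 : cos (atan y) != 0.
  by rewrite gt_eqF// cos_gt0_pihalf// atan_gtNpi2 atan_ltpi2.
have -> : sin (atan y) = y * cos (atan y).
  by rewrite -{2}(atanK y) /tan divfK.
have -> : cos k = 2 * sin k * y.
  transitivity (sin k / sin k * cos k); first by rewrite divff ?gt_eqF// mul1r.
  by rewrite /y; lra.
lra.
Qed.

End Profile.

(** * The critical frequency for a finite exponent *)

Section Optimum.
Variable R : realType.
Implicit Types (k x y p : R).

(** Logarithm of the ratio of the ground frequencies of the two clusters: the
    coefficient of 2 p in [balance]. *)
Definition log_ratio k : R := ln k + ln (1 - cut_position k) - ln (pi / 2).

(** The part of [balance] that does not depend on p. *)
Definition log_slope k : R :=
  ln k - ln (1 - cut_position k) + ln (cut_speed k).

(** Logarithm of the ratio of the two terms of [energy'], the growth of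
    k^(2p) against the decay of (pi / (2 (1 - a)))^(2p); see
    [energy'_balance]. *)
Definition balance p k : R := 2 * p * log_ratio k - log_slope k.

Definition log_ratio' k : R := k^-1 + cut_speed k / (1 - cut_position k).

Definition log_slope' k : R :=
  k^-1 - cut_speed k / (1 - cut_position k) - cut_accel k / cut_speed k.

Definition in_range k := kmin R < k <= pi / 2.

Lemma in_range_pi k : in_range k -> 0 < k < pi.
Proof.
by move=> /andP[k0 k1]; have := kmin_gt0 R; have := pihalf_lt_pi R; lra.
Qed.

Lemma in_range_pihalf k : in_range k -> 0 < k <= pi / 2.
Proof. by move=> /andP[k0 k1]; have := kmin_gt0 R; lra. Qed.

Lemma der_ln (f : R -> R) x df : 0 < f x -> is_derive x 1 f df ->
  is_derive x 1 (fun y => ln (f y)) (df / f x).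
Proof.
by move=> fx Df; apply: der_eq (der_comp Df (is_derive1_ln fx)) _; rewrite mulrC.
Qed.

Lemma is_derive_log_free k : in_range k ->
  is_derive k 1 (fun y => ln (1 - cut_position y))
    (cut_speed k / (1 - cut_position k)).
Proof.
move=> kR; have /andP[_ a1] := cut_position_in kR.
have Da := is_derive_cut_position (in_range_pi kR).
have m_gt0 : 0 < 1 - cut_position k by rewrite subr_gt0.
apply: der_eq (der_ln (f := fun y => 1 - cut_position y) m_gt0
  (der_sub (der_cst 1 k) Da)) _.
by rewrite sub0r opprK.
Qed.

Lemma is_derive_log_ratio k : in_range k ->
  is_derive k 1 log_ratio (log_ratio' k).
Proof.
move=> kR; have /andP[k_gt0 _] := in_range_pi kR.
apply: der_eq (der_sub (der_add (is_derive1_ln k_gt0) (is_derive_log_free kR))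
  (der_cst (ln (pi / 2)) k)) _.
by rewrite subr0.
Qed.

Lemma is_derive_log_slope k : in_range k ->
  is_derive k 1 log_slope (log_slope' k).
Proof.
move=> kR; have /andP[k_gt0 _] := in_range_pi kR.
have Db := is_derive_cut_speed (in_range_pi kR).
have b_gt0 := cut_speed_gt0 (in_range_pihalf kR).
apply: der_eq (der_add (der_sub (is_derive1_ln k_gt0) (is_derive_log_free kR))
  (der_ln b_gt0 Db)) _.
by rewrite mulNr.
Qed.

Lemma is_derive_balance p k : in_range k ->
  is_derive k 1 (balance p) (2 * p * log_ratio' k - log_slope' k).
Proof.
move=> kR.
exact: der_sub (der_scale (2 * p) (is_derive_log_ratio kR)) (is_derive_log_slope kR).
Qed.

Lemma log_ratio'_gt0 k : in_range k -> 0 < log_ratio' k.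
Proof.
move=> kR; have /andP[k_gt0 _] := in_range_pi kR.
have b_gt0 := cut_speed_gt0 (in_range_pihalf kR).
have /andP[_ a1] := cut_position_in kR.
by rewrite addr_gt0 ?invr_gt0// divr_gt0// subr_gt0.
Qed.

(** For p >= 1/2 the term - 1/k of - log_slope' is absorbed by 2 p log_ratio',
    and what remains is positive because [cut_position] and [cut_speed] both
    decrease. *)
Lemma balance'_gt0 p k : 2^-1 <= p -> in_range k ->
  0 < 2 * p * log_ratio' k - log_slope' k.
Proof.
move=> p_ge kR; have /andP[k_gt0 _] := in_range_pi kR.
have b_gt0 := cut_speed_gt0 (in_range_pihalf kR).
have c_gt0 := cut_accel_gt0 (in_range_pihalf kR).
have /andP[_ a1] := cut_position_in kR.
have m'_gt0 := log_ratio'_gt0 kR.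
have r_gt0 : 0 < cut_speed k / (1 - cut_position k) by rewrite divr_gt0// subr_gt0.
have s_gt0 : 0 < cut_accel k / cut_speed k by rewrite divr_gt0.
have h : log_ratio' k <= 2 * p * log_ratio' k.
  by rewrite ler_peMl ?(ltW m'_gt0)//; lra.
rewrite subr_gt0; apply: lt_le_trans h; rewrite /log_slope' /log_ratio'.
by move: r_gt0 s_gt0; move: (_ / _) (_ / _) => r s; lra.
Qed.

Lemma log_ratio_pihalf : log_ratio (pi / 2) = 0.
Proof. by rewrite /log_ratio cut_position_pihalf subr0 ln1 addr0 subrr. Qed.

Lemma log_ratio_lt0 k : kmin R < k < pi / 2 -> log_ratio k < 0.
Proof.
move=> /andP[k0 k1]; rewrite -log_ratio_pihalf.
apply: (@der_lt _ _ log_ratio') => // z zI.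
  by apply: is_derive_log_ratio; rewrite /in_range; lra.
by apply: log_ratio'_gt0; rewrite /in_range; lra.
Qed.

Lemma balance_lt p x y : 2^-1 <= p -> kmin R < x -> x < y -> y <= pi / 2 ->
  balance p x < balance p y.
Proof.
move=> p_ge x0 xy y1.
apply: (@der_lt _ _ (fun z => 2 * p * log_ratio' z - log_slope' z)) => // z zI.
  by apply: is_derive_balance; rewrite /in_range; lra.
by apply: balance'_gt0 => //; rewrite /in_range; lra.
Qed.

Lemma balance_pihalf p : 0 < balance p (pi / 2).
Proof.
have pi0 := pi_gt0 R.
rewrite /balance log_ratio_pihalf mulr0 sub0r oppr_gt0.
rewrite /log_slope cut_position_pihalf subr0 ln1 subr0.
rewrite /cut_speed cut_position_pihalf sin_pihalf expr1n addr0.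
have h_gt0 : 0 < pi / 2 :> R by rewrite divr_gt0.
have -> : 1 + 3 * 1 = 4 :> R by lra.
have b_gt0 : 0 < 2 / 4 / (pi / 2) :> R by rewrite divr_gt0// divr_gt0.
rewrite -lnM ?posrE// mulrC divfK ?gt_eqF ?divr_gt0//.
apply: ln_lt0; apply/andP; split; lra.
Qed.

(** Since log_ratio < 0, it suffices to bound log_ratio - log_slope, where ln k
    cancels; this makes the point a = 1/2 work for all p >= 1/2 at once. *)
Lemma balance_halfway p k : 2^-1 <= p -> in_range k -> cut_position k = 2^-1 ->
  balance p k < 0.
Proof.
move=> p_ge kR ak; have /andP[k_gt0 k_le] := in_range_pihalf kR.
have pi0 := pi_gt0 R.
have kneq : k != pi / 2.
  by apply/eqP => kE; move: ak; rewrite kE cut_position_pihalf; lra.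
have m_lt0 : log_ratio k < 0.
  apply: log_ratio_lt0; have /andP[-> _] := kR.
  by rewrite lt_neqAle kneq.
have h : 2 * p * log_ratio k <= log_ratio k by rewrite ler_neMl ?(ltW m_lt0)//; lra.
apply: (le_lt_trans (y := log_ratio k - log_slope k)).
  by rewrite /balance lerD2r.
have -> : log_ratio k - log_slope k =
    2 * ln (1 - cut_position k) - (ln (cut_speed k) + ln (pi / 2)).
  by rewrite /log_ratio /log_slope; lra.
have b_gt0 := cut_speed_gt0 (in_range_pihalf kR).
have l2 : ln (1 - cut_position k) < 0 by apply: ln_lt0; rewrite ak; lra.
have q_gt0 : 0 < 1 + 3 * sin k ^+ 2 by rewrite ltr_pwDl// mulr_ge0// sqr_ge0.
have l3 : 0 <= ln (cut_speed k) + ln (pi / 2).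
  have h_gt0 : 0 < pi / 2 :> R by rewrite divr_gt0.
  rewrite -lnM ?posrE//; apply: ln_ge0.
  rewrite /cut_speed ak mulrAC -mulrA.
  have h1 : 1 <= 2 / (1 + 3 * sin k ^+ 2) + 2^-1.
    have : 2^-1 <= 2 / (1 + 3 * sin k ^+ 2).
      rewrite ler_pdivlMr//.
      have := sqr_ge0 (cos k); rewrite cos2sin2; lra.
    lra.
  have h2 : 1 <= pi / 2 / k by rewrite ler_pdivlMr// mul1r.
  by apply: le_trans h2 _; rewrite ler_peMl// mulr_ge0 ?invr_ge0 ?ltW// divr_gt0.
lra.
Qed.

Lemma balance_root p : 2^-1 <= p ->
  exists2 k, kmin R < k < pi / 2 & balance p k = 0.
Proof.
move=> p_ge; have [|k1 kR ak1] := @cut_position_surj R 2^-1; first by lra.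
have b1 := balance_halfway p_ge kR ak1.
have b2 := balance_pihalf p; have /andP[k0 kp] := kR.
have [||k /andP[]] := @IVT R (balance p) k1 (pi / 2) 0 kp.
- apply: derivable_within_continuous => z /andP[]; rewrite !bnd_simp => z0 z1.
  by have [|//] := @is_derive_balance p z _; rewrite /in_range; lra.
- by rewrite min_l ?max_r ?ltW// (lt_trans b1).
rewrite !bnd_simp => kk1 kkp bk; exists k => //.
rewrite (lt_le_trans k0 kk1) lt_neqAle kkp andbT.
by apply: contraTneq b2 => kE; rewrite -kE bk ltxx.
Qed.

Definition optimal_frequency p : R :=
  xget (pi / 2) [set k | kmin R < k < pi / 2 /\ balance p k = 0].

Lemma optimal_frequencyP p : 2^-1 <= p ->
  kmin R < optimal_frequency p < pi / 2 /\ balance p (optimal_frequency p) = 0.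
Proof.
move=> /balance_root[k kI bk]; rewrite /optimal_frequency.
by case: xgetP => [y _ []|/(_ k) []].
Qed.

Lemma balance_gt0P p k : 2^-1 <= p -> in_range k ->
  (0 < balance p k) = (optimal_frequency p < k).
Proof.
move=> p_ge /andP[k0 k1]; have [/andP[w0 w1] bo] := optimal_frequencyP p_ge.
case: (ltgtP (optimal_frequency p) k) => [kw|wk|kw].
- by rewrite -bo balance_lt.
- by apply/negbTE; rewrite -leNgt -bo ltW// balance_lt// ltW.
- by rewrite -kw bo ltxx.
Qed.

Lemma balance_lt0P p k : 2^-1 <= p -> in_range k ->
  (balance p k < 0) = (k < optimal_frequency p).
Proof.
move=> p_ge /andP[k0 k1]; have [/andP[w0 w1] bo] := optimal_frequencyP p_ge.
case: (ltgtP (optimal_frequency p) k) => [kw|wk|kw].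
- by apply/negbTE; rewrite -leNgt -bo ltW// balance_lt.
- by rewrite -bo balance_lt// ltW.
- by rewrite -kw bo ltxx.
Qed.

Lemma optimal_frequency_uniq p k : 2^-1 <= p -> kmin R < k < pi / 2 ->
  balance p k = 0 -> optimal_frequency p = k.
Proof.
move=> p_ge /andP[k0 k1] bk; have kR : in_range k by rewrite /in_range k0 ltW.
have := balance_gt0P p_ge kR; have := balance_lt0P p_ge kR; rewrite bk ltxx.
by case: ltgtP.
Qed.

Definition energy p k : R := expR (2 * p * ln k) +
  expR (2 * p * (ln (pi / 2) - ln (1 - cut_position k))).

Definition energy' p k : R := 2 * p * (expR (2 * p * ln k) / k -
  expR (2 * p * (ln (pi / 2) - ln (1 - cut_position k))) *
    (cut_speed k / (1 - cut_position k))).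

Lemma is_derive_energy p k : in_range k ->
  is_derive k 1 (energy p) (energy' p k).
Proof.
move=> kR; have /andP[k_gt0 _] := in_range_pi kR.
have D1 := der_scale (2 * p) (is_derive1_ln k_gt0).
have D2 := der_scale (2 * p)
  (der_sub (der_cst (ln (pi / 2)) k) (is_derive_log_free kR)).
apply: der_eq (der_add (der_comp D1 (is_derive_expR _)) (der_comp D2 (is_derive_expR _))) _.
rewrite /energy'; move: (expR _) (expR _) => u v; lra.
Qed.

Lemma energy'_balance p k : in_range k -> energy' p k = 2 * p *
  expR (2 * p * (ln (pi / 2) - ln (1 - cut_position k)) +
    (ln (cut_speed k) - ln (1 - cut_position k))) * (expR (balance p k) - 1).
Proof.
move=> kR; have /andP[k_gt0 _] := in_range_pi kR.
have b_gt0 := cut_speed_gt0 (in_range_pihalf kR).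
have /andP[_ a1] := cut_position_in kR.
have e1 : k^-1 = expR (- ln k) by rewrite expRN lnK// posrE.
have e2 : cut_speed k / (1 - cut_position k) =
    expR (ln (cut_speed k) - ln (1 - cut_position k)).
  by rewrite expRD expRN !lnK// posrE// subr_gt0.
rewrite /energy' e1 e2 -[RHS]mulrA [X in _ = _ * X]mulrBr mulr1 -!expRD; congr (_ * (expR _ - _)).
by rewrite /balance /log_ratio /log_slope; lra.
Qed.

Lemma optimal_energy p k : 1 <= p -> in_range k -> k != optimal_frequency p ->
  energy p (optimal_frequency p) < energy p k.
Proof.
move=> p_ge kR; have p_ge' : 2^-1 <= p by lra.
have /andP[k0 k1] := kR.
have [/andP[w0 w1] _] := optimal_frequencyP p_ge'.
have pref z : 0 < 2 * p * expR (2 * p * (ln (pi / 2) - ln (1 - cut_position z)) +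
    (ln (cut_speed z) - ln (1 - cut_position z))).
  by rewrite mulr_gt0 ?expR_gt0//; lra.
rewrite neq_lt => /orP[ko|wk].
- rewrite -ltrN2; apply: (@der_lt _ (fun z => - energy p z) (fun z => - energy' p z)) => // z zI.
    by apply/der_opp/is_derive_energy; rewrite /in_range; lra.
  have zR : in_range z by rewrite /in_range; lra.
  rewrite energy'_balance// oppr_gt0 pmulr_rlt0// subr_lt0 expR_lt1.
  by rewrite balance_lt0P//; lra.
- apply: (@der_lt _ _ (energy' p)) => // z zI.
    by apply/is_derive_energy; rewrite /in_range; lra.
  have zR : in_range z by rewrite /in_range; lra.
  rewrite energy'_balance// pmulr_rgt0// subr_gt0 expR_gt1.
  by rewrite balance_gt0P//; lra.
Qed.

(** The value of p at which k is critical. *)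
Definition exponent k : R := log_slope k / (2 * log_ratio k).

Definition exponent' k : R := log_slope' k / (2 * log_ratio k) +
  log_slope k * - (2 * log_ratio' k / (2 * log_ratio k) ^+ 2).

Lemma balance_exponent p k : kmin R < k < pi / 2 ->
  (balance p k == 0) = (exponent k == p).
Proof.
move=> /log_ratio_lt0 m_lt0.
have m2 : 2 * log_ratio k != 0 by rewrite mulf_neq0// lt_eqF.
rewrite /exponent subr_eq0 eq_sym -mulrA mulrCA.
by apply/eqP/eqP => [->|<-]; rewrite ?mulfK// divfK.
Qed.

Lemma is_derive_exponent k : kmin R < k < pi / 2 ->
  is_derive k 1 exponent (exponent' k).
Proof.
move=> kI; have /andP[k0 k1] := kI.
have kR : in_range k by rewrite /in_range k0 ltW.
have m2 : 2 * log_ratio k != 0 by rewrite mulf_neq0// lt_eqF// log_ratio_lt0.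
exact: der_mul (is_derive_log_slope kR)
  (der_inv (der_scale 2 (is_derive_log_ratio kR)) m2).
Qed.

(** Differentiate balance (exponent k) k = 0: [balance] increases in k and
    decreases in p. *)
Lemma exponent'_gt0 p : 2^-1 <= p -> 0 < exponent' (optimal_frequency p).
Proof.
move=> p_ge; have [wI bo] := optimal_frequencyP p_ge; have /andP[w0 w1] := wI.
set k := optimal_frequency p in wI bo w0 w1 *.
have kR : in_range k by rewrite /in_range w0 ltW.
have m_lt0 := log_ratio_lt0 wI.
have nE : log_slope k = 2 * p * log_ratio k.
  by move: bo; rewrite /balance; lra.
have -> : exponent' k = (2 * p * log_ratio' k - log_slope' k) / (- (2 * log_ratio k)).
  rewrite /exponent' nE invrN.
  have m2 : 2 * log_ratio k != 0 by rewrite mulf_neq0// lt_eqF.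
  have -> : 2 * p * log_ratio k * - (2 * log_ratio' k / (2 * log_ratio k) ^+ 2) =
    - (2 * p * log_ratio' k) * (2 * log_ratio k / (2 * log_ratio k) ^+ 2) by lra.
  have -> : 2 * log_ratio k / (2 * log_ratio k) ^+ 2 = (2 * log_ratio k)^-1.
    by rewrite expr2 invfM mulrA divff// mul1r.
  by lra.
by rewrite divr_gt0 ?balance'_gt0// oppr_gt0 pmulr_rlt0.
Qed.

Lemma exponentK p : 2^-1 <= p -> exponent (optimal_frequency p) = p.
Proof.
move=> p_ge; have [wI bo] := optimal_frequencyP p_ge.
by apply/eqP; rewrite -balance_exponent// bo.
Qed.

Lemma is_derive_optimal_frequency p : 2^-1 < p ->
  is_derive p 1 optimal_frequency (exponent' (optimal_frequency p))^-1.
Proof.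
move=> p_gt; have [wI bo] := optimal_frequencyP (ltW p_gt).
have /andP[w0 w1] := wI; set k := optimal_frequency p in wI bo w0 w1 *.
have kp : exponent k = p by exact: exponentK (ltW p_gt).
have kI : \forall z \near k, kmin R < z < pi / 2.
  near=> z; apply/andP; split; near: z; [exact: lt_nbhsr|exact: lt_nbhsl].
rewrite -{1}kp.
apply: is_derive_inverse (is_derive_exponent wI) _.
- near=> z.
  have zI : kmin R < z < pi / 2 by near: z.
  apply: optimal_frequency_uniq => //; last by apply/eqP; rewrite balance_exponent.
  apply: ltW; near: z.
  have /cvgr_gt := der_continuous (is_derive_exponent wI).
  by apply; rewrite kp.
- near=> z; apply: der_continuous (is_derive_exponent _).
  by near: z.
- by rewrite gt_eqF// exponent'_gt0// ltW.
Unshelve. all: end_near. Qed.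

End Optimum.

(** * Smoothness of the optimal cut *)

Section Smoothness.
Variable R : realType.
Implicit Types (U V : set R) (f g : R -> R).

(** Differentiability n times on [U], with the derivatives as witnesses rather
    than as values of the derivative operator: the closure properties below
    then hold on arbitrary sets, by induction on n. *)
Fixpoint diff_upto n U f : Prop :=
  if n is m.+1 then
    exists2 f', (forall x, U x -> is_derive x 1 f (f' x)) & diff_upto m U f'
  else True.

Lemma diff_upto_prec n U f : diff_upto n.+1 U f -> diff_upto n U f.
Proof.
elim: n f => [//|n IH] f [f' Df f'n]; exists f' => //; exact: IH.
Qed.

Lemma diff_upto_sub n U V f : U `<=` V -> diff_upto n V f -> diff_upto n U f.
Proof.
move=> UV; elim: n f => [//|n IH] f [f' Df f'n].
by exists f' => [x /UV|]; [exact: Df|exact: IH].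
Qed.

Lemma diff_upto_eq n U f g : open U -> (forall x, U x -> f x = g x) ->
  diff_upto n U f -> diff_upto n U g.
Proof.
move=> Uop fg; case: n => [//|n] [f' Df f'n]; exists f' => // x Ux.
apply: near_eq_is_derive (Df x Ux).
near=> y; apply: fg; near: y; exact: open_nbhs_nbhs.
Unshelve. all: end_near. Qed.

Lemma diff_upto_derivative n U f f' : open U ->
  (forall x, U x -> is_derive x 1 f (f' x)) ->
  diff_upto n.+1 U f -> diff_upto n U f'.
Proof.
move=> Uop Df [f'' Df' f''n]; apply: diff_upto_eq f''n => // x Ux.
by rewrite -(der_derive1 (Df x Ux)) -(der_derive1 (Df' x Ux)).
Qed.

Lemma diff_upto_smooth U f : open U -> (forall n, diff_upto n U f) ->
  smooth_on U f.
Proof.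
move=> Uop fU n x Ux; move: (fU n.+1); clear fU.
elim: n f => [|n IH] f fn.
  by case: fn => f' Df _; have [] := Df x Ux.
have [f' Df _] := fn.
rewrite derive1Sn; apply: IH; apply: diff_upto_derivative fn => // y Uy.
by rewrite derive1E; have [? _] := Df y Uy; exact: derivableP.
Qed.

Lemma diff_upto_cst n U c : diff_upto n U (fun=> c).
Proof.
elim: n c => [//|n IH] c; exists (fun=> 0) => [x _|//]; exact: der_cst.
Qed.

Lemma diff_upto_id n U : diff_upto n U (fun x => x).
Proof.
case: n => [//|n]; exists (fun=> 1) => [x _|]; first exact: der_id.
exact: diff_upto_cst.
Qed.

Lemma diff_upto_add n U f g : diff_upto n U f -> diff_upto n U g ->
  diff_upto n U (fun x => f x + g x).
Proof.
elim: n f g => [//|n IH] f g [f' Df f'n] [g' Dg g'n].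
exists (fun x => f' x + g' x); last exact: IH.
by move=> x Ux; exact: der_add (Df x Ux) (Dg x Ux).
Qed.

Lemma diff_upto_opp n U f : diff_upto n U f -> diff_upto n U (fun x => - f x).
Proof.
elim: n f => [//|n IH] f [f' Df f'n].
exists (fun x => - f' x); last exact: IH.
by move=> x Ux; exact: der_opp (Df x Ux).
Qed.

Lemma diff_upto_mul n U f g : diff_upto n U f -> diff_upto n U g ->
  diff_upto n U (fun x => f x * g x).
Proof.
elim: n f g => [//|n IH] f g fn gn.
have f0 := diff_upto_prec fn; have g0 := diff_upto_prec gn.
case: fn gn => f' Df f'n [g' Dg g'n].
exists (fun x => f' x * g x + f x * g' x).
  by move=> x Ux; exact: der_mul (Df x Ux) (Dg x Ux).
by apply: diff_upto_add; exact: IH.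
Qed.

Lemma diff_upto_comp n U V f g : (forall x, U x -> V (g x)) ->
  diff_upto n V f -> diff_upto n U g -> diff_upto n U (fun x => f (g x)).
Proof.
move=> gUV; elim: n f => [//|n IH] f [f' Df f'n] gn.
have g0 := diff_upto_prec gn; case: gn => g' Dg g'n.
exists (fun x => f' (g x) * g' x).
  by move=> x Ux; exact: der_comp (Dg x Ux) (Df _ (gUV x Ux)).
by apply: diff_upto_mul => //; exact: IH.
Qed.

Lemma diff_upto_invr n : diff_upto n [set x : R | x != 0] (fun x => x^-1).
Proof.
elim: n => [//|n IH]; exists (fun x => - (x^-1 * x^-1)).
  move=> x x0; apply: der_eq (der_inv (der_id x) x0) _.
  by rewrite expr2 invfM mul1r.
by apply: diff_upto_opp; exact: diff_upto_mul.
Qed.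

Lemma diff_upto_inv n U f : (forall x, U x -> f x != 0) ->
  diff_upto n U f -> diff_upto n U (fun x => (f x)^-1).
Proof. by move=> f0; apply: diff_upto_comp (diff_upto_invr n). Qed.

Lemma diff_upto_ln n U f : (forall x, U x -> 0 < f x) ->
  diff_upto n U f -> diff_upto n U (fun x => ln (f x)).
Proof.
move=> f0; apply: (@diff_upto_comp _ _ [set x : R | 0 < x] (@ln R)) => //.
case: n => [//|n]; exists (fun x => x^-1) => [x x0|]; first exact: is_derive1_ln.
by apply: diff_upto_sub (diff_upto_invr n) => x /= /lt0r_neq0.
Qed.

Lemma diff_upto_sin_cos n U : diff_upto n U (@sin R) /\ diff_upto n U (@cos R).
Proof.
elim: n => [//|n [sn cn]]; split.
  by exists (@cos R) => // x _; exact: is_derive_sin.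
exists (fun x => - sin x) => [x _|]; first exact: is_derive_cos.
exact: diff_upto_opp.
Qed.

Lemma diff_upto_atan n U f : diff_upto n U f ->
  diff_upto n U (fun x => atan (f x)).
Proof.
apply: (@diff_upto_comp _ _ setT (@atan R)) => //.
case: n => [//|n]; exists (fun x => (1 + x * x)^-1) => [x _|].
  by rewrite -expr2; exact: is_derive1_atan.
apply: diff_upto_inv => [x _|]; first by rewrite gt_eqF// -expr2 ltr_pwDl// sqr_ge0.
apply: diff_upto_add (diff_upto_cst _ _ _) _.
by apply: diff_upto_mul; exact: diff_upto_id.
Qed.

(** Bootstrapping an autonomous differential equation. *)
Lemma diff_upto_ode n U V (F K : R -> R) : (forall x, U x -> V (K x)) ->
  (forall m, diff_upto m V F) ->
  (forall x, U x -> is_derive x 1 K (F (K x))) -> diff_upto n U K.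
Proof.
move=> KUV Fn DK; elim: n => [//|n IH]; exists (fun x => F (K x)) => //.
exact: diff_upto_comp KUV (Fn n) IH.
Qed.

Definition open_range : set R := [set k | kmin R < k < pi / 2].

Lemma open_range_open : open open_range.
Proof.
rewrite (_ : open_range = `]kmin R, pi / 2[); first exact: interval_open.
by apply/seteqP; split=> x; rewrite /= in_itv.
Qed.

Lemma open_range_in k : open_range k -> in_range k.
Proof. by move=> /andP[k0 k1]; rewrite /in_range k0 ltW. Qed.

Lemma cut_position_diff_upto n : diff_upto n open_range (@cut_position R).
Proof.
have [sn cn] := diff_upto_sin_cos n open_range.
apply: diff_upto_mul; last first.
  apply: (diff_upto_inv _ (diff_upto_id n _)) => k /open_range_in/in_range_pi.
  by case/andP => /lt0r_neq0.
apply/diff_upto_atan/diff_upto_mul/diff_upto_cst/diff_upto_mul => //.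
apply: diff_upto_inv => // k /open_range_in/in_range_pi kI.
by rewrite gt_eqF// sin_gt0_pi.
Qed.

Lemma cut_speed_diff_upto n : diff_upto n open_range (@cut_speed R).
Proof.
have : diff_upto n open_range (fun k => - - cut_speed k).
  apply: diff_upto_opp; apply: diff_upto_derivative (cut_position_diff_upto n.+1).
    exact: open_range_open.
  by move=> k /open_range_in/in_range_pi; exact: is_derive_cut_position.
by apply: diff_upto_eq open_range_open _ => k _; rewrite opprK.
Qed.

Lemma exponent_diff_upto n : diff_upto n open_range (@exponent R).
Proof.
have k_gt0 k : open_range k -> 0 < k.
  by move=> /open_range_in/in_range_pi/andP[].
have lk := diff_upto_ln k_gt0 (diff_upto_id n _).
have m_gt0 k : open_range k -> 0 < 1 - cut_position k.
  by move=> /open_range_in/cut_position_in/andP[_]; rewrite subr_gt0.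
have lm := diff_upto_ln m_gt0 (diff_upto_add (diff_upto_cst n _ 1)
  (diff_upto_opp (cut_position_diff_upto n))).
have b_gt0 k : open_range k -> 0 < cut_speed k.
  by move=> /open_range_in/in_range_pihalf/cut_speed_gt0.
have lb := diff_upto_ln b_gt0 (cut_speed_diff_upto n).
apply: diff_upto_mul.
  exact: diff_upto_add (diff_upto_add lk (diff_upto_opp lm)) lb.
apply: diff_upto_inv => [k kI|].
  by rewrite mulf_neq0// lt_eqF// log_ratio_lt0.
apply: diff_upto_mul (diff_upto_cst n _ 2) _.
exact: diff_upto_add (diff_upto_add lk lm) (diff_upto_cst n _ _).
Qed.

Definition half_line : set R := [set p | 2^-1 < p].

Lemma half_line_open : open half_line.
Proof. exact: open_gt. Qed.

(** The critical frequency solves K' = 1 / exponent' (K). *)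
Lemma optimal_frequency_diff_upto n : diff_upto n half_line (@optimal_frequency R).
Proof.
apply: (@diff_upto_ode _ _ (open_range `&` [set k | exponent' k != 0])
   (fun k => (exponent' k)^-1)).
- move=> p /ltW p_ge; split; first by have [] := optimal_frequencyP p_ge.
  by rewrite /= gt_eqF// exponent'_gt0.
- move=> m; apply: diff_upto_inv => [k []//|].
  apply: (@diff_upto_sub _ _ open_range) => [k []//|].
  apply: diff_upto_derivative open_range_open _ (exponent_diff_upto m.+1).
  by move=> k; exact: is_derive_exponent.
- by move=> p; exact: is_derive_optimal_frequency.
Qed.

Lemma optimal_cut_diff_upto n :
  diff_upto n half_line (fun p => cut_position (optimal_frequency p)).
Proof.
apply: diff_upto_comp (cut_position_diff_upto n) (optimal_frequency_diff_upto n).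
by move=> p /ltW p_ge; have [] := optimal_frequencyP p_ge.
Qed.

End Smoothness.

(** * The minimizers *)

Section Minimizer.
Variable R : realType.

Lemma inf_min (S : set R) x : S x -> (forall y, S y -> x <= y) -> inf S = x.
Proof.
move=> Sx xS; apply/eqP; rewrite eq_le; apply/andP; split.
  by apply: ge_inf => //; exists x.
by apply: lb_le_inf; [exists x | exact: xS].
Qed.

(** The symmetries reduce the infimum over all partitions to the a in [0, 1[. *)
Lemma unique_minimizer (p : \bar R) (a0 : R) : 0 <= a0 < 1 ->
  (forall a, 0 <= a < 1 -> a != a0 ->
    LambdaD p (star_partition a0) < LambdaD p (star_partition a)) ->
  unique (fun a : R => 0 <= a < 1 /\
    LambdaD p (star_partition a) = LD2 (star3 R) p) a0.
Proof.
move=> a01 a_lt.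
have LE : LD2 (star3 R) p = LambdaD p (star_partition a0).
  apply: inf_min.
    by exists (star_partition a0) => //; exact: star_partition_exhaustive_rigid.
  move=> _ [P /star_partition_LambdaD[a [aI _ ->]] <-].
  by have [->|ne] := eqVneq a a0; [exact: lexx | exact/ltW/a_lt].
split=> // a [aI aE]; apply/esym/eqP/negPn/negP => /(a_lt _ aI).
by rewrite aE LE ltxx.
Qed.

Lemma star_partition_lambda1 (k : R) : in_range k ->
  cluster_lambda1 (star_G1 (cut_position k)) = k ^+ 2 /\
  cluster_lambda1 (star_G2 (cut_position k)) =
    (pi / (2 * (1 - cut_position k))) ^+ 2.
Proof.
move=> kR; have aI := cut_position_in kR.
have kI := in_range_pihalf kR; have /andP[k_gt0 k_le] := kI.
split; last exact: star_G2_lambda1.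
by apply: star_G1_lambda1 => //; exact: cut_position_eq.
Qed.

Lemma LambdaD_energy (p k : R) : in_range k ->
  LambdaD p%:E (star_partition (cut_position k)) =
  (2^-1 * energy p k) `^ p^-1.
Proof.
move=> kR; have [E1 E2] := star_partition_lambda1 kR.
have /andP[_ a_lt1] := cut_position_in kR.
have /andP[k_gt0 _] := in_range_pihalf kR.
rewrite /LambdaD E1 E2; congr ((_ * _) `^ _).
have m_gt0 : 0 < 1 - cut_position k by rewrite subr_gt0.
have pi2 : 0 < pi / 2 :> R by rewrite divr_gt0// pi_gt0.
have -> : pi / (2 * (1 - cut_position k)) = pi / 2 / (1 - cut_position k).
  by rewrite invfM mulrA.
have sq_powR x : 0 < x -> (x ^+ 2) `^ p = expR (2 * p * ln x).
  move=> x_gt0; rewrite /powR gt_eqF ?exprn_gt0// lnXn//.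
  by congr expR; rewrite mulrnAr -mulrnAl mulr_natl.
have q_gt0 : 0 < pi / 2 / (1 - cut_position k) by rewrite divr_gt0.
by rewrite (sq_powR k k_gt0) (sq_powR _ q_gt0) /energy ln_div.
Qed.

Lemma optimal_cut_finite (p a : R) : 1 <= p -> 0 <= a < 1 ->
  a != cut_position (optimal_frequency p) ->
  LambdaD p%:E (star_partition (cut_position (optimal_frequency p))) <
  LambdaD p%:E (star_partition a).
Proof.
move=> p_ge /cut_position_surj[k kR <-] ne.
have p_ge' : 2^-1 <= p by lra.
have [wI _] := optimal_frequencyP p_ge'.
have wR := open_range_in wI.
have p_gt0 : 0 < p by lra.
rewrite !LambdaD_energy// gt0_ltr_powR ?invr_gt0 ?nnegrE ?mulr_ge0 ?addr_ge0 ?expR_ge0//.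
rewrite ltr_pM2l ?invr_gt0// optimal_energy//.
by apply: contra ne => /eqP ->.
Qed.

Lemma optimal_cut_infinite (a : R) : 0 <= a < 1 -> a != 0 ->
  LambdaD +oo (star_partition 0) < LambdaD +oo (star_partition a).
Proof.
move=> aI a_neq0; have /andP[a_ge0 a_lt1] := aI.
have a_gt0 : 0 < a by rewrite lt_neqAle eq_sym a_neq0.
have [|E1 E2] := @star_partition_lambda1 (pi / 2).
  by rewrite /in_range kmin_lt lexx.
rewrite cut_position_pihalf subr0 mulr1 in E1 E2.
rewrite /LambdaD E1 E2 star_G2_lambda1// maxxx lt_max; apply/orP; right.
have pi0 := pi_gt0 R.
have m_gt0 : 0 < 1 - a by rewrite subr_gt0.
rewrite ltr_pXn2r// ?nnegrE ?divr_ge0 ?mulr_ge0 ?ltW//.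
by rewrite ltr_pM2l// ltf_pV2 ?posrE ?mulr_gt0//; lra.
Qed.

Definition optimal_cut (p : \bar R) : R :=
  if p is p'%:E then cut_position (optimal_frequency p') else 0.

Lemma optimal_cut_cvg0 : optimal_cut p%:E @[p --> +oo] --> (0 : R).
Proof.
apply/cvgr0Pnorm_lt => e e_gt0.
pose y := Num.min (e / 2) 2^-1.
have y_gt0 : 0 < y by rewrite /y lt_min; lra.
have y_lt1 : y < 1 by rewrite gt_min; apply/orP; right; lra.
have y_lte : y < e by rewrite gt_min; apply/orP; left; lra.
have [|k kR ky] := @cut_position_surj R y; first by rewrite ltW.
have /andP[k0 k1] := kR.
have k_neq : k != pi / 2.
  by apply: contraTneq y_gt0 => kE; rewrite -ky kE cut_position_pihalf ltxx.
have kI : open_range k by rewrite /open_range /= k0 lt_neqAle k_neq.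
near=> p.
have p_ge : 1 <= p by near: p; exact: nbhs_pinfty_ge.
have p_ge' : 2^-1 <= p by lra.
have p_gt : exponent k < p by near: p; apply: nbhs_pinfty_gt; exact: num_real.
have [wI _] := optimal_frequencyP p_ge'.
have kw : k < optimal_frequency p.
  rewrite -balance_lt0P//.
  have : balance (exponent k) k == 0 by rewrite balance_exponent ?eqxx.
  have := log_ratio_lt0 kI; rewrite /balance => m_lt0 /eqP <-.
  by rewrite ltrD2r ltr_nM2r// ltr_pM2l.
have /andP[w0 w1] := wI.
have wR := in_range_pihalf (open_range_in wI).
rewrite /optimal_cut ger0_norm ?cut_position_ge0//.
apply: lt_trans y_lte; rewrite -ky cut_position_lt ?ltW//.
by have /andP[] := in_range_pihalf kR.
Unshelve. all: end_near. Qed.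

End Minimizer.

Theorem proposition7p3 (R : realType) :
  [/\ (* the {G_1(a), G_2(a)} are exhaustive rigid 2-partitions *)
      forall a : R, 0 <= a < 1 ->
        exhaustive_rigid_partition (star_partition a),
      (* and up to symmetry there are no others *)
      forall P : cluster_pair (star3 R), exhaustive_rigid_partition P ->
        exists! a : R, 0 <= a < 1 /\
          exists s : {perm 'I_3}, star_symmetric s P (star_partition a)
    & exists a_ : \bar R -> R,
      [/\ (* a_ p is the unique minimizer *)
          forall p : \bar R, (1%:E <= p)%E ->
            unique (fun a : R => 0 <= a < 1 /\
              LambdaD p (star_partition a) = LD2 (star3 R) p) (a_ p),
          forall p : R, 1 <= p -> 0 < a_ p%:E,
          (* smoothness on [1, +oo[: extension to an open neighbourhood *)
          exists (U : set R) (g : R -> R),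
            [/\ open U, `[1, +oo[ `<=` U, smooth_on U g,
                forall p : R, 1 <= p -> g p = a_ p%:E
              & forall p : R, 1 <= p -> g^`()%classic p < 0]
        & a_ p%:E @[p --> +oo] --> (0 : R)]].
Proof.
have half (p : R) : 1 <= p -> 2^-1 <= p by lra.
split; first exact: star_partition_exhaustive_rigid.
  move=> P /star_partition_LambdaD[a [aI [s sP] _]].
  exists a; split; first by split=> //; exists s.
  by move=> a' [aI' [s' sP']]; exact: star_symmetric_inj sP sP'.
exists (@optimal_cut R); split.
- move=> [p||//].
  + rewrite lee_fin => p_ge; apply: unique_minimizer => [|a aI ne].
      have [wI _] := optimal_frequencyP (half p p_ge).
      exact/cut_position_in/open_range_in.
    exact: optimal_cut_finite.
  + move=> _; apply: unique_minimizer => [|a]; last exact: optimal_cut_infinite.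
    by rewrite lexx ltr01.
- move=> p /half/optimal_frequencyP[/andP[w0 w1] _].
  rewrite /= -[X in X < _]cut_position_pihalf cut_position_lt//.
  exact: lt_trans (kmin_gt0 R) w0.
- exists (@half_line R), (fun p => cut_position (optimal_frequency p)); split=> //.
  + by move=> p; rewrite /= in_itv /= andbT /half_line /=; lra.
  + by apply: diff_upto_smooth (@half_line_open R) _ => n; exact: optimal_cut_diff_upto.
  + move=> p p_ge; have p_gt : 2^-1 < p by lra.
    have [wI _] := optimal_frequencyP (half p p_ge).
    have wR := open_range_in wI.
    rewrite (der_derive1 (der_comp (is_derive_optimal_frequency p_gt)
      (is_derive_cut_position (in_range_pi wR)))).
    rewrite mulNr oppr_lt0 mulr_gt0 ?invr_gt0 ?exponent'_gt0 ?half//.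
    exact/cut_speed_gt0/in_range_pihalf.
- exact: optimal_cut_cvg0.
Qed.
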